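(* Let $r \geq 3$ and $l \geq 1$ be fixed integers with $l \leq r/2$, let $p = p(n) \in [0,1]$, and let $d = d(n) = (n-(r-1))p$. If $d = \Theta(1)$, then with high probability $$\tau^{(r-1)}(H_r(n,p)) < (1+o(1))\binom{n}{r-1}\psi_{r,l}(d),$$ where $$\psi_{r,l}(d) = \frac{\zeta_1}{2l}\left(1 - \exp\left(-\frac{d}{2}\left(1+e^{-d}\right)\right)\right) + \left(\frac{\zeta_2}{l} + \left(1-\frac{1}{l}\right)^{r-1}\right)\left(1 - e^{-d}\right),$$ and $\zeta_1 = \zeta_1(r,l)$, $\zeta_2 = \zeta_2(r,l)$ are defined as follows: $\zeta_1$ is the probability that, when each element of an $(r-1)$-element set is placed into one of $l$ labelled blocks uniformly at random and independently of the other elements, every block receives at least two elements; and $\zeta_2 = 1 - \zeta_1$.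
   Context: An $r$-graph $G$ is a set of $r$-element subsets (edges) of a vertex set $V(G)$. An $(r-1)$-cover of $G$ is a collection of $(r-1)$-element subsets of $V(G)$ such that every edge of $G$ contains at least one member of the collection; $\tau^{(r-1)}(G)$ is the minimum size of an $(r-1)$-cover of $G$. $H_r(n,p)$ denotes the random $r$-graph on a set $V$ of $n$ labelled vertices in which each $r$-element subset of $V$ is an edge with probability $p$, independently of the others; $d$ is the expected number of edges containing a given $(r-1)$-set. $d = \Theta(1)$ means that $d$ is bounded above and bounded away from $0$ by positive constants for all large $n$. ''With high probability'' means with probability tending to $1$ as $n \to \infty$; here $o(1)$ denotes a deterministic quantity tending to $0$ as $n \to \infty$. *)

(* Defs.v *)
From mathcomp Require Import all_boot all_order all_algebra.
From mathcomp Require Import all_classical all_reals all_analysis.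
Import Order.TTheory GRing.Theory Num.Theory numFieldNormedType.Exports.

Set Implicit Arguments.
Unset Strict Implicit.
Unset Printing Implicit Defensive.

Local Open Scope ring_scope.

Section Hypergraphs.
Variable V : finType.
Implicit Types (G C : {set {set V}}) (r k : nat).

Definition ksubsets k : {set {set V}} := [set e : {set V} | #|e| == k].

Definition is_rgraph r G : bool := G \subset ksubsets r.

Definition is_cover k G C : bool :=
  (C \subset ksubsets k) && [forall e in G, exists c in C, c \subset e].

(* The default value [ksubsets k] of the arg min is itself a k-cover as soon
   as every edge of G has at least k elements, in particular when G is an
   r-graph and k = r - 1; the arg min is then a genuine minimum. *)
Definition tau k G : nat :=
  #|[arg min_(C < ksubsets k | is_cover k G C) #|C|]%N|.

End Hypergraphs.

Section RandomHypergraph.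
Variable R : realType.

(* Law of H_r(n, p) on the r-graphs with vertex set 'I_n: independence of the
   edges makes the mass of G a product over all r-subsets of 'I_n. *)
Definition Hr_mass (r n : nat) (p : R) (G : {set {set 'I_n}}) : R :=
  \prod_(e in ksubsets 'I_n r) (if e \in G then p else 1 - p).

Definition Hr_prob (r n : nat) (p : R) (E : pred {set {set 'I_n}}) : R :=
  \sum_(G : {set {set 'I_n}} | is_rgraph r G && E G) Hr_mass r p G.

End RandomHypergraph.

Section Psi.
Variable R : realType.

(* Placing the r - 1 elements independently and uniformly into l blocks is
   choosing a uniform function from 'I_(r - 1) to 'I_l. *)
Definition zeta1 (r l : nat) : R :=
  #|[set f : {ffun 'I_r.-1 -> 'I_l} |
      [forall b : 'I_l, (2 <= #|[set x | f x == b]|)%N]]|%:R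
  / #|{: {ffun 'I_r.-1 -> 'I_l}}|%:R.

Definition zeta2 (r l : nat) : R := 1 - zeta1 r l.

Definition psi (r l : nat) (d : R) : R :=
  zeta1 r l / (2 * l%:R) * (1 - expR (- (d / 2 * (1 + expR (- d)))))
  + (zeta2 r l / l%:R + (1 - l%:R^-1) ^+ r.-1) * (1 - expR (- d)).

Definition is_Theta1 (d : nat -> R) : Prop :=
  exists a b : R, [/\ 0 < a, 0 < b & \forall n \near \oo%classic, a <= d n <= b].

End Psi.

(* Main.v *)
Require Import Defs.
From mathcomp Require Import all_boot all_order all_algebra.
From mathcomp Require Import all_classical all_reals all_analysis.
From mathcomp Require Import fintype finset ring lra zify.
Import Order.TTheory GRing.Theory Num.Theory numFieldNormedType.Exports.

(** Split the vertices at random into l blocks numbered 0, ..., l - 1, let the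
weight of a set be the sum of the block numbers of its elements modulo l, and fix
a random residue t. An (r - 1)-set S that misses m blocks is called eligible when
its weight is one of the m + 1 residues t, t + 1, ..., t + m. Deleting from an
r-set e a vertex of block i lowers the weight by i, and e cannot miss more
consecutive blocks than it misses in all, so e contains an eligible set
([exists_hits]). Averaged over partitions and residues a set is eligible with
probability at most 1/l + (1 - 1/l)^(r - 1). Only the eligible sets that lie in
an edge are needed, which accounts for the factor 1 - exp (- d).

When all blocks of S have at least two elements, the cover can be thinned. Let M
be a random family of vertex sets, and let the parity of S count modulo 2 the
members of M that meet every block once and lie within the first two vertices of
S in each block. If a, b, c are the first three vertices of e in one block, a
transversal survives the deletion of exactly two of them, so the parities of
e - a, e - b, e - c add up to 0: one or three of these sets are even, and the even
ones suffice ([exists_even]). This halves the cover. Moreover, call an edge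
private to an even S when the two alternatives are odd. An even S is needed only
if it has a private edge, or an edge neither of whose two other even sets has a
private edge. There are about d edges through S; each is private with probability
1/2, and otherwise the alternatives both lack private edges with probability about
exp (- d/2) exp (- d/2). So S is needed with probability about
1 - exp (- d/2 (1 + exp (- d))), the first term of psi.

The last estimate must bound from below the probability that S is not needed.
For fixed M, the events that the various edges through S do not call for S are
positively correlated, by Harris' inequality with the order reversed on the edges
through S ([prob_not_kept_ge]). Averaging over M uses Jensen's inequality
([sum_even_kept_le]) and a second moment bound for the number of private edges,
where correlations vanish because toggling one member of M flips a single parity
([h_uncorrelated], [second_moment]).

This bounds the mean of tau ([mean_tau_le]). As one more edge changes tau by at
most 1, the variance of tau is at most the mean number of edges
([variance_lipschitz]), and Chebyshev's inequality concludes ([tail_bound]). *)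

Set Implicit Arguments.
Unset Strict Implicit.
Unset Printing Implicit Defensive.

(** * Elementary bounds on the exponential *)

Local Open Scope ring_scope.

Section Exponential.
Variable R : realType.

Lemma exp_le_1B (x : R) : 0 <= x -> x < 1 -> expR (- (x / (1 - x))) <= 1 - x.
Proof.
move=> x0 x1; have q0 : 0 < 1 - x by rewrite subr_gt0.
rewrite expRN -[X in _ <= X]invrK lef_pV2 ?posrE ?expR_gt0 ?invr_gt0 //.
apply: le_trans (expR_ge1Dx _); rewrite le_eqVlt; apply/orP; left; apply/eqP.
by field; rewrite lt0r_neq0.
Qed.

Lemma expR_le_inv (x : R) : x < 1 -> expR x <= (1 - x)^-1.
Proof.
move=> x1; rewrite -[expR x]invrK -expRN lef_pV2 ?posrE ?expR_gt0 ?subr_gt0 //.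
exact: expR_ge1Dx.
Qed.

Lemma inv_1B_le (x : R) : 0 <= x -> x <= 2^-1 -> (1 - x)^-1 <= 1 + 2 * x.
Proof.
by move=> x0 x2; rewrite -div1r ler_pdivrMr; nra.
Qed.

Lemma exp_lip (a b : R) : 0 <= a -> 0 <= b -> expR (- a) <= expR (- b) + `|a - b|.
Proof.
move=> ha hb; have [ab|ba] := leP b a.
  by apply: le_trans (_ : expR (- b) <= _); [rewrite ler_expR lerN2|rewrite lerDl].
have E : expR (- b) = expR (- a) * expR (- (b - a)) by rewrite -expRD; congr expR; ring.
have H1 : 1 - (b - a) <= expR (- (b - a)) := expR_ge1Dx _.
have H2 : expR (- a) <= 1 by rewrite -expR0 ler_expR; lra.
have H3 := expR_ge0 (- a).
rewrite E ltr0_norm ?subr_lt0 //; nra.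
Qed.

(** Monotonicity lets the number of vertices that matter for a given set be
replaced by the number of all vertices outside it. *)
Lemma le_x1expNx (x y : R) : 0 <= x -> x <= y ->
  x * (1 + expR (- x)) <= y * (1 + expR (- y)).
Proof.
move=> x0 xy.
have E : expR (- y) = expR (- x) * expR (- (y - x)) by rewrite -expRD; congr expR; ring.
have H1 : 1 - (y - x) <= expR (- (y - x)) := expR_ge1Dx _.
have H2 : x * expR (- x) <= 1.
  rewrite expRN ler_pdivrMr ?expR_gt0 // mul1r.
  by apply: le_trans (expR_ge1Dx x); rewrite lerDr.
have H3 : 0 <= x * expR (- x) by rewrite mulr_ge0 ?expR_ge0.
have H4 := expR_ge0 (- y).
have H5 : x * expR (- x) - x * expR (- y) <= y - x.
  rewrite E; set q := expR (- (y - x)) in H1 *; nra.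
nra.
Qed.

End Exponential.

(** * Independent Bernoulli coordinates *)

Section BernoulliExpectation.
Variables (R : realType) (I : finType) (p : R).
Implicit Types (s : seq I) (f g : {set I} -> R) (G : {set I}).

(** The law of the random set is unfolded one coordinate at a time, so that
inequalities for product measures go by induction on the list of coordinates. *)
Fixpoint Expect s f : R :=
  if s is e :: s' then p * Expect s' (fun G => f (e |: G)) + (1 - p) * Expect s' f
  else f set0.

Lemma eq_Expect s f g :
  (forall G, {subset G <= s} -> f G = g G) -> Expect s f = Expect s g.
Proof.
elim: s f g => [|e s IH] f g fg /=.
  by apply: fg => x; rewrite inE.
congr (_ * _ + _ * _); apply: IH => G sG; apply: fg => x.
  by rewrite !inE => /orP[->//|/sG ->]; rewrite orbT.
by move=> /sG; rewrite inE => ->; rewrite orbT.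
Qed.

Lemma Expect_const s c : Expect s (fun=> c) = c.
Proof. by elim: s => //= e s ->; rewrite -mulrDl addrC subrK mul1r. Qed.

Lemma ExpectD s f g : Expect s (fun G => f G + g G) = Expect s f + Expect s g.
Proof. by elim: s f g => //= e s IH f g; rewrite !IH; ring. Qed.

Lemma ExpectZ s c f : Expect s (fun G => c * f G) = c * Expect s f.
Proof. by elim: s f => //= e s IH f; rewrite !IH; ring. Qed.

Lemma ExpectB s f g : Expect s (fun G => f G - g G) = Expect s f - Expect s g.
Proof. by elim: s f g => //= e s IH f g; rewrite !IH; ring. Qed.

Lemma Expect_sum (T : Type) (r : seq T) (P : pred T) s (F : T -> {set I} -> R) :
  Expect s (fun G => \sum_(i <- r | P i) F i G) = \sum_(i <- r | P i) Expect s (F i).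
Proof.
elim: r => [|i r IH].
  by rewrite big_nil -[RHS](Expect_const s); apply: eq_Expect => G _; rewrite big_nil.
rewrite big_cons -IH; case: ifP => Pi; last first.
  by apply: eq_Expect => G _; rewrite big_cons Pi.
by rewrite -ExpectD; apply: eq_Expect => G _; rewrite big_cons Pi.
Qed.

Lemma Expect_prod s (F : I -> bool -> R) : uniq s ->
  Expect s (fun G => \prod_(e <- s) F e (e \in G)) =
  \prod_(e <- s) (p * F e true + (1 - p) * F e false).
Proof.
elim: s => [|e s IH] /= => [_|/andP[es us]]; first by rewrite !big_nil.
rewrite big_cons -(IH us) [RHS]mulrDl -!mulrA.
congr (_ * _ + _ * _); rewrite -ExpectZ; apply: eq_Expect => G sG; rewrite big_cons.
  rewrite setU11; congr (_ * _); rewrite big_seq [RHS]big_seq.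
  apply: eq_bigr => x xs; rewrite !inE; case: eqVneq => // xe.
  by rewrite -xe xs in es.
by case: (boolP (e \in G)) => // /sG; rewrite (negPf es).
Qed.

(** The recursion agrees with the explicit sum over configurations because the
indicator of a configuration is a product over the coordinates. *)
Lemma ExpectE s f : uniq s ->
  Expect s f = \sum_(G : {set I} | G \subset s)
     (\prod_(e <- s) (if e \in G then p else 1 - p)) * f G.
Proof.
move=> us; transitivity (Expect s (fun G' => \sum_(G : {set I} | G \subset s)
    f G * \prod_(e <- s) ((e \in G') == (e \in G))%:R)).
  apply: eq_Expect => G' sG'.
  have sG's : G' \subset s by apply/subsetP.
  rewrite (bigD1 G') //= [X in _ * X]big1 ?mulr1; last by move=> e _; rewrite eqxx.
  rewrite big1 ?addr0 // => G /andP[sG neG].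
  have [e es eG] : exists2 e, e \in s & (e \in G') != (e \in G).
    apply/hasP; apply: contraNT neG => /hasPn h; apply/eqP/setP => e.
    have [/h|es] := boolP (e \in s); first by rewrite negbK => /eqP.
    rewrite (contraNF ((subsetP sG) e)) //.
    by rewrite (contraNF (sG' e)).
  by rewrite (big_rem _ es) /= (negPf eG) mul0r mulr0.
rewrite Expect_sum; apply: eq_bigr => G sG; rewrite ExpectZ mulrC; congr (_ * _).
rewrite (Expect_prod (fun e b => (b == (e \in G))%:R)) //; apply: eq_bigr => e _.
by case: (e \in G); rewrite /= ?mulr1 ?mulr0 ?addr0 ?add0r.
Qed.

Hypothesis p01 : 0 <= p <= 1.
Let p0 : 0 <= p. Proof. by case/andP: p01. Qed.
Let q0 : 0 <= 1 - p. Proof. by rewrite subr_ge0; case/andP: p01. Qed.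

Lemma le_Expect s f g :
  (forall G, {subset G <= s} -> f G <= g G) -> Expect s f <= Expect s g.
Proof.
elim: s f g => [|e s IH] f g fg /=.
  by apply: fg => x; rewrite inE.
apply: lerD; apply: ler_wpM2l => //; apply: IH => G sG; apply: fg => x.
  by rewrite !inE => /orP[->//|/sG ->]; rewrite orbT.
by move=> /sG; rewrite inE => ->; rewrite orbT.
Qed.

Lemma Expect_ge0 s f : (forall G, 0 <= f G) -> 0 <= Expect s f.
Proof. by move=> f0; rewrite -[X in X <= _](Expect_const s 0); apply: le_Expect. Qed.

(** Efron-Stein: exposing one coordinate adds at most p (1 - p) to the
variance of a function that moves by at most 1 along each coordinate. *)
Lemma variance_lipschitz s f :
  (forall e G, `|f (e |: G) - f G| <= 1) ->
  Expect s (fun G => f G ^+ 2) - Expect s f ^+ 2 <= (size s)%:R * p.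
Proof.
elim: s f => [|e s IH] f lipf /=; first by rewrite subrr mul0r.
set E1 := Expect s (fun G => f (e |: G)); set E0 := Expect s f.
set Q1 := Expect s (fun G => f (e |: G) ^+ 2); set Q0 := Expect s (fun G => f G ^+ 2).
have V0 : Q0 - E0 ^+ 2 <= (size s)%:R * p by apply: IH.
have V1 : Q1 - E1 ^+ 2 <= (size s)%:R * p.
  apply: (IH (fun G => f (e |: G))) => e' G.
  by rewrite setUCA; apply: lipf.
have D : (E1 - E0) ^+ 2 <= 1.
  rewrite -ler_sqrt // sqrtr1 sqrtr_sqr ler_norml -[E1 - E0]ExpectB.
  rewrite -[X in X <= _ <= _](Expect_const s) -[X in _ <= _ <= X](Expect_const s).
  apply/andP; split; apply: le_Expect => G _;
    by have := lipf e G; rewrite ler_norml => /andP[].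
rewrite -natr1.
have -> : p * Q1 + (1 - p) * Q0 - (p * E1 + (1 - p) * E0) ^+ 2 =
  p * (Q1 - E1 ^+ 2) + (1 - p) * (Q0 - E0 ^+ 2) + p * (1 - p) * (E1 - E0) ^+ 2.
  by ring.
have H1 := ler_wpM2l p0 V1; have H0 := ler_wpM2l q0 V0.
have H2 : p * (1 - p) * (E1 - E0) ^+ 2 <= p * 1 * 1.
  apply: ler_pM; [exact: mulr_ge0|exact: sqr_ge0| |exact: D].
  by rewrite ler_wpM2l // lerBlDr lerDl.
by nra.
Qed.

Lemma chebyshev_Expect s f (a : R) : Expect s f < a ->
  (forall e G, `|f (e |: G) - f G| <= 1) ->
  Expect s (fun G => (a <= f G)%R%:R) <= (size s)%:R * p / (a - Expect s f) ^+ 2.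
Proof.
set mu := Expect s f => mua lipf.
have am : 0 < a - mu by rewrite subr_gt0.
rewrite ler_pdivlMr ?exprn_gt0 // -[X in _ <= X]addr0.
apply: le_trans (_ : Expect s (fun G => (f G - mu) ^+ 2) <= _).
  rewrite mulrC -ExpectZ; apply: le_Expect => G _; case: (boolP (a <= f G)) => [afG|_] /=.
    have h : a - mu <= f G - mu by rewrite lerD2r.
    by rewrite mulr1 ler_sqr ?nnegrE ?(ltW am) ?(le_trans (ltW am) h).
  by rewrite mulr0 sqr_ge0.
rewrite addr0; apply: le_trans (variance_lipschitz s lipf).
rewrite (eq_Expect (g := fun G => f G ^+ 2 + ((- (2 * mu)) * f G + mu ^+ 2))).
  by rewrite !ExpectD ExpectZ Expect_const -/mu le_eqVlt; apply/orP; left; apply/eqP; ring.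
by move=> G _; ring.
Qed.

Section Harris.
Variable up : pred I.

(** The direction of monotonicity may depend on the coordinate, but it is the same
for all functions considered together. *)
Definition monof f := forall e G,
  if up e then f G <= f (e |: G) else f (e |: G) <= f G.

(** Harris' inequality: along one coordinate the covariance is p (1 - p) times the
product of two increments of the same sign. *)
Lemma harris2 s f g : monof f -> monof g ->
  Expect s f * Expect s g <= Expect s (fun G => f G * g G).
Proof.
elim: s f g => [|e s IH] f g mf mg //=.
have sh h : monof h -> monof (fun G => h (e |: G)).
  by move=> mh e' G; rewrite setUCA; apply: mh.
have H1 := IH _ _ (sh _ mf) (sh _ mg); have H0 := IH _ _ mf mg.
set f1 := Expect s (fun G => f (e |: G)) in H1 *; set f0 := Expect s f in H0 *.
set g1 := Expect s (fun G => g (e |: G)) in H1 *; set g0 := Expect s g in H0 *.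
have D : 0 <= (f1 - f0) * (g1 - g0).
  case E: (up e).
    apply: mulr_ge0; rewrite subr_ge0; apply: le_Expect => G _.
      by have := mf e G; rewrite E.
    by have := mg e G; rewrite E.
  apply: mulr_le0; rewrite subr_le0; apply: le_Expect => G _.
    by have := mf e G; rewrite E.
  by have := mg e G; rewrite E.
have := ler_wpM2l p0 H1; have := ler_wpM2l q0 H0.
have := mulr_ge0 (mulr_ge0 p0 q0) D; nra.
Qed.

Lemma monof_prod (T : Type) (r : seq T) (F : T -> {set I} -> R) :
  (forall i, monof (F i)) -> (forall i G, 0 <= F i G) ->
  monof (fun G => \prod_(i <- r) F i G).
Proof.
move=> mF F0 e G; case E: (up e); apply: ler_prod => i _; rewrite F0 /=;
  by have := mF i e G; rewrite E.
Qed.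

Lemma harris (T : Type) (r : seq T) s (F : T -> {set I} -> R) :
  (forall i, monof (F i)) -> (forall i G, 0 <= F i G) ->
  \prod_(i <- r) Expect s (F i) <= Expect s (fun G => \prod_(i <- r) F i G).
Proof.
move=> mF F0; elim: r => [|i r IH].
  rewrite big_nil -[X in X <= _](Expect_const s).
  by apply: le_Expect => G _; rewrite big_nil.
rewrite big_cons; apply: le_trans (_ : Expect s (F i) *
   Expect s (fun G => \prod_(j <- r) F j G) <= _).
  by apply: ler_wpM2l; rewrite ?Expect_ge0.
apply: le_trans (harris2 s (mF i) (monof_prod r mF F0)) _.
by apply: le_Expect => G _; rewrite big_cons.
Qed.

End Harris.

Lemma Expect_disjoint s (E : {set I}) : uniq s -> {subset E <= s} ->
  Expect s (fun G => [disjoint E & G]%:R) = (1 - p) ^+ #|E|.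
Proof.
move=> us sE.
rewrite (eq_Expect (g := fun G => \prod_(e <- s) (~~ ((e \in E) && (e \in G)))%:R)).
  rewrite (Expect_prod (fun e b => (~~ ((e \in E) && b))%:R)) //.
  rewrite (eq_bigr (fun e => if e \in E then 1 - p else 1)); last first.
    by move=> e _; case: (e \in E); rewrite /= ?mulr0 ?mulr1 ?add0r // addrC subrK.
  rewrite -big_mkcond /= -big_filter.
  rewrite (perm_big (enum E)) /=; last first.
    apply: uniq_perm; [exact: filter_uniq|exact: enum_uniq|move=> e].
    by rewrite mem_filter mem_enum; case: (boolP (e \in E)) => // /sE ->.
  by rewrite big_const_seq count_predT -cardE iter_mulr mulr1.
move=> G sG; rewrite disjoint_subset.
have [/subsetP h|/subsetPn[e eE]] := boolP (E \subset _).
  rewrite big1 // => e _; case: (boolP (e \in E)) => //= /h.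
  by rewrite inE => ->.
rewrite inE negbK => eG; rewrite (big_rem e) /= ?eE ?eG ?mul0r //.
exact: sE.
Qed.

Lemma Expect_mem_disjoint s a (E : {set I}) : uniq s -> {subset E <= s} ->
  a \in s -> a \notin E ->
  Expect s (fun G => ((a \in G) && [disjoint E & G])%:R) = p * (1 - p) ^+ #|E|.
Proof.
move=> us sE as_ aE.
have sE' : {subset a |: E <= s}.
  by move=> x; rewrite !inE => /orP[/eqP->//|/sE].
have := Expect_disjoint us sE'; rewrite cardsU1 aE exprS.
rewrite (eq_Expect (g := fun G => [disjoint E & G]%:R -
    ((a \in G) && [disjoint E & G])%:R)); last first.
  move=> G _; rewrite -!setI_eq0 setIUl setU_eq0 setI_eq0 disjoints1.
  by case: (a \in G); case: (_ == _); rewrite /= ?subr0 ?subrr.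
by rewrite ExpectB Expect_disjoint // => h; lra.
Qed.

End BernoulliExpectation.

(** * Blocks, crossing sets and parities *)

Section Blocks.
Local Open Scope nat_scope.
Variables (n l : nat) (f : 'I_n -> 'I_l).
Implicit Types (S e g K : {set 'I_n}) (x y v a b : 'I_n) (M : {set {set 'I_n}}).

Definition block_rank S x := #|[set y in S | (f y == f x) && (y < x)]|.
Definition core S := [set x in S | block_rank S x < 2].
Definition triple e x := [set y in e | (f y == f x) && (block_rank e y < 3)].
(** Over a random partition, the probability of this condition is zeta1. *)
Definition thick S := [forall j, 2 <= #|[set x in S | f x == j]|].
Definition crossing g := [forall j, #|[set x in g | f x == j]| == 1].
(** Restricting to the first two vertices of each block makes the parity of e :\ a
depend, for the first three vertices a of a block of e, only on which two of the
three remain. *)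
Definition parity M S := odd #|[set g in M | crossing g && (g \subset core S)]|.

Lemma block_rankD1 e x y : x \in e ->
  block_rank e y = ((f x == f y) && (x < y)) + block_rank (e :\ x) y.
Proof.
move=> xe; rewrite /block_rank (cardsD1 x) inE xe; congr (_ + #|pred_of_set _|).
by apply/setP => z; rewrite !inE andbA.
Qed.

Lemma block_rankU1 v S y : v \notin S ->
  block_rank (v |: S) y = ((f v == f y) && (v < y)) + block_rank S y.
Proof. by move=> vS; rewrite (block_rankD1 y (setU11 v S)) setU1K. Qed.

Lemma block_rank_lt e x y : x \in e -> f x = f y -> x < y -> block_rank e x < block_rank e y.
Proof.
move=> xe fxy xy; apply: proper_card; apply/properP; split.
  apply/subsetP => z; rewrite !inE => /and3P[-> /eqP -> zx] /=.
  by rewrite fxy eqxx (ltn_trans zx xy).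
by exists x; rewrite !inE ?xe ?fxy ?eqxx ?xy //= ltnn ?andbF.
Qed.

Lemma block_rank_inj e x y : x \in e -> y \in e -> f x = f y -> block_rank e x = block_rank e y ->
  x = y.
Proof.
move=> xe ye fxy rxy; apply/val_inj => /=; apply/eqP; case: ltngtP => // h.
  by have := block_rank_lt xe fxy h; rewrite rxy ltnn.
by have := block_rank_lt ye (esym fxy) h; rewrite rxy ltnn.
Qed.

(** Ranks run through 0, 1, 2, ... along each block. *)
Lemma card_block_rank_lt e (j : 'I_l) k : k <= #|[set y in e | f y == j]| ->
  #|[set y in e | (f y == j) && (block_rank e y < k)]| = k.
Proof.
set B := [set y in e | f y == j] => kB.
have rB y : y \in B -> block_rank e y < #|B|.
  rewrite inE => /andP[ye /eqP fy]; apply: proper_card; apply/properP; split.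
    by apply/subsetP => z; rewrite !inE fy => /and3P[-> ->].
  by exists y; rewrite !inE ?ye ?fy ?eqxx // ltnn ?andbF.
have us : uniq (map (block_rank e) (enum B)).
  rewrite map_inj_in_uniq ?enum_uniq // => x y.
  rewrite !mem_enum !inE => /andP[xe /eqP fx] /andP[ye /eqP fy].
  by apply: block_rank_inj; rewrite // fx fy.
have sB : {subset map (block_rank e) (enum B) <= iota 0 #|B|}.
  move=> z /mapP[y]; rewrite mem_enum => /rB yB ->.
  by rewrite mem_iota.
have [|_ eqB] := uniq_min_size us sB; first by rewrite size_iota size_map -cardE.
have pB : perm_eq (map (block_rank e) (enum B)) (iota 0 #|B|).
  by apply: uniq_perm; rewrite ?iota_uniq.
have := permP pB (fun i => i < k); rewrite count_map.
rewrite -[in X in _ = X -> _](subnKC kB) iotaD count_cat.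
rewrite (_ : count _ (iota 0 k) = k); last first.
  apply/eqP; rewrite -[X in _ == X](size_iota 0 k) -all_count.
  by apply/allP => i; rewrite mem_iota.
rewrite (_ : count _ (iota _ _) = 0) ?addn0; last first.
  apply/eqP; rewrite -leqn0 leqNgt -has_count; apply/hasPn => i.
  by rewrite mem_iota add0n -leqNgt => /andP[].
move=> ck; rewrite -[RHS]ck -size_filter cardE.
apply: perm_size; apply: uniq_perm.
- exact: enum_uniq.
- by rewrite filter_uniq ?enum_uniq.
by move=> y; rewrite mem_enum [RHS]mem_filter mem_enum !inE /= andbA andbC.
Qed.

Lemma card_triple e x : 3 <= #|[set y in e | f y == f x]| -> #|triple e x| = 3.
Proof. exact: card_block_rank_lt. Qed.

(** Deleting one of the first three vertices of a block promotes the other two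
to be the first two. *)
Lemma core_rem e x y a : a \in triple e x ->
  (y \in core (e :\ a)) =
  [&& y != a, y \in e & if f y == f x then block_rank e y < 3 else block_rank e y < 2].
Proof.
rewrite inE => /and3P[ae /eqP fa ra]; rewrite !inE.
case: (eqVneq y a) => //= ya; case ye: (y \in e) => //=.
rewrite (block_rankD1 y ae) fa eq_sym; case: eqP => /= fy; last by rewrite add0n.
case: (ltnP a y) => /= ay; first by rewrite add1n.
rewrite add0n; rewrite leq_eqVlt in ay; case/orP: ay => [|ay].
  by rewrite (inj_eq val_inj) (negPf ya).
have := block_rank_lt ye (etrans (esym fy) (esym fa)) ay.
rewrite [block_rank e y](block_rankD1 _ ae).
by rewrite [a < y]ltnNge (ltnW ay) andbF add0n => h; lia.
Qed.

(** A crossing set within the first three vertices of the block of x and the first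
two of the other blocks survives the deletion of exactly two of those
three vertices. *)
Lemma even_sum_crossing M e x : #|triple e x| = 3 ->
  ~~ odd (\sum_(a in triple e x) #|[set g in M | crossing g && (g \subset core (e :\ a))]|).
Proof.
move=> c3; pose K := [set y in e | if f y == f x then block_rank e y < 3 else block_rank e y < 2].
have subK g a : a \in triple e x ->
    (g \subset core (e :\ a)) = (g \subset K) && (a \notin g).
  move=> at_; rewrite -subsetD1; apply/subsetP/subsetP => h y /h;
  by rewrite (core_rem y at_) !inE.
rewrite (eq_bigr (fun a => \sum_(g in M | crossing g)
    ((g \subset K) && (a \notin g)))); last first.
  move=> a at_; rewrite -sum1_card big_mkcond [RHS]big_mkcond /=.
  apply: eq_bigr => g _; rewrite !inE -subK //.
  by case: (g \in M); case: (crossing g) => //=; case: (g \subset _).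
rewrite exchange_big /= (big_morph odd oddD (erefl _)).
elim/big_ind : _ => // [x1 x2|g /andP[_ tg]]; first by case: x1; case: x2.
case: (boolP (g \subset K)) => gK /=; last by rewrite big1.
have -> : \sum_(a in triple e x) (a \notin g) = #|triple e x :\: g|.
  rewrite -sum1_card big_mkcond [RHS]big_mkcond /=; apply: eq_bigr => a _.
  by rewrite [a \in _ :\: _]inE; case: (a \in triple _ _); case: (a \in g).
rewrite cardsD c3 (_ : triple e x :&: g = [set y in g | f y == f x]).
  by rewrite (eqP (forallP tg (f x))).
apply/setP => y; rewrite !inE; case: (boolP (y \in g)); rewrite ?andbF //=.
by move=> /(subsetP gK); rewrite inE andbT; case: (f y == f x) => /andP[->] // ->.
Qed.

(** In particular one or all three of the sets are even. *)
Lemma parity_rem3 M e x a b c : #|triple e x| = 3 -> triple e x = [set a; b; c] ->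
  a != b -> a != c -> b != c ->
  parity M (e :\ a) (+) parity M (e :\ b) (+) parity M (e :\ c) = false.
Proof.
move=> c3 te ab ac bc; have := even_sum_crossing M c3.
rewrite te -setUA big_setU1 ?inE ?negb_or ?ab //= big_setU1 ?inE // big_set1.
by rewrite !oddD addbA => /negPf.
Qed.

Lemma card3P e x a : a \in triple e x -> #|triple e x| = 3 ->
  exists b c, [/\ a != b, a != c, b != c & triple e x = [set a; b; c]].
Proof.
move=> at_; rewrite (cardsD1 a) at_ add1n => /eqP; rewrite eqSS => /cards2P[b [c [bc E]]].
have := setD1K at_; rewrite E => H.
have : b \in [set b; c] by rewrite !inE eqxx.
have : c \in [set b; c] by rewrite !inE eqxx orbT.
rewrite -E !inE => /andP[ca _] /andP[ba _].
by exists b, c; split; rewrite // 1?eq_sym // -H setUA.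
Qed.

Lemma exists_even M e x : 3 <= #|[set y in e | f y == f x]| ->
  exists2 a, a \in triple e x & ~~ parity M (e :\ a).
Proof.
move=> c3; have t3 := card_triple c3.
have /card_gt0P[a at_] : 0 < #|triple e x| by rewrite t3.
have [b [c [ab ac bc E]]] := card3P at_ t3.
have := parity_rem3 M t3 E ab ac bc.
have [pa|pa] := boolP (parity M (e :\ a)); last by exists a.
have [pb|pb] := boolP (parity M (e :\ b)).
  by case: (boolP (parity _ _)) => // pc _; exists c => //; rewrite E !inE eqxx !orbT.
by exists b => //; rewrite E !inE eqxx !orbT.
Qed.

(** The exchanged sets (v |: S) :\ a, for a in mates S v, are the two sets that can,
for thick S, replace S in covering the edge v |: S. *)
Definition mates S v := triple (v |: S) v :\ v.
(** Only the edges v |: S in which v is one of the first three vertices of its block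
can require S: in any other edge S is not one of the three linked deletions. *)
Definition joinable S := [set v | (v \notin S) && (block_rank S v < 3)].

Lemma mem_triple_joinable S v : v \in joinable S -> v \in triple (v |: S) v.
Proof.
rewrite inE => /andP[vS rv]; rewrite inE setU11 eqxx /=.
by rewrite block_rankU1 // ltnn andbF.
Qed.

Lemma card_block_U1 S v : v \notin S -> thick S ->
  3 <= #|[set y in v |: S | f y == f v]|.
Proof.
move=> vS /forallP/(_ (f v)); rewrite (cardsD1 v [set y in _ | _]) !inE !eqxx.
rewrite add1n ltnS => h; apply: leq_trans h (subset_leq_card _).
apply/subsetP => y; rewrite !inE => /andP[yS ->]; rewrite yS orbT !andbT.
by apply: contraNneq vS => <-.
Qed.

Lemma card_mates S v : v \in joinable S -> thick S -> #|mates S v| = 2.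
Proof.
move=> vR fS; have := vR; rewrite inE => /andP[vS _].
have := card_triple (card_block_U1 vS fS).
by rewrite (cardsD1 v) mem_triple_joinable // add1n => /eqP; rewrite eqSS => /eqP.
Qed.

(** The three linked parities add up to 0, and that of S is 0. *)
Lemma parity_mates M S v a b : v \in joinable S -> thick S -> ~~ parity M S ->
  a \in mates S v -> b \in mates S v -> parity M ((v |: S) :\ a) = parity M ((v |: S) :\ b).
Proof.
move=> vR fS pS ao bo; have [->//|ab] := eqVneq a b.
have := vR; rewrite inE => /andP[vS _].
have t3 := card_triple (card_block_U1 vS fS).
have [va at_] := setD1P ao; have [vb bt] := setD1P bo.
have [b' [c' [h1 h2 h3 E]]] := card3P (mem_triple_joinable vR) t3.
have := parity_rem3 M t3 E h1 h2 h3; rewrite setU1K // (negPf pS) addFb.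
move: at_ bt; rewrite E !inE (negPf va) (negPf vb) /=.
move=> /orP[]/eqP Ea /orP[]/eqP Eb; move: ab; rewrite Ea Eb ?eqxx // => _;
by do 2!case: (parity _ _).
Qed.

End Blocks.

(** * The cover *)

Section Cover.
Local Open Scope nat_scope.
Variables (n l : nat) (f : 'I_n -> 'I_l).
Implicit Types (S e g K : {set 'I_n}) (x y v a b : 'I_n) (M G : {set {set 'I_n}}).

(** An edge is private to S when the sets that could replace S are odd, hence not in
the cover. *)
Definition has_private M G S := [exists v in joinable f S,
  (v |: S \in G) && [forall a in mates f S v, parity f M ((v |: S) :\ a)]].
(** An edge makes S indispensable when each of the sets that could replace S is odd
or has no private edge of its own, and so is not guaranteed to be kept. *)
Definition kept M G S := [exists v in joinable f S,
  (v |: S \in G) &&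
  [forall a in mates f S v, parity f M ((v |: S) :\ a) || ~~ has_private M G ((v |: S) :\ a)]].
Definition weight S := \sum_(x in S) f x.
Definition missed S := [set j : 'I_l | j \notin f @: S].
(** A set that misses more blocks is accepted for more residues; this compensates
for the vertices that cannot be deleted from an edge. *)
Definition hits (t : 'I_l) S :=
  [exists k : 'I_#|missed S|.+1, weight S == t + k %[mod l]].
Definition extends G S := [exists v, (v \notin S) && (v |: S \in G)].
Definition turan_cover r M t G := [set S in ksubsets 'I_n r.-1 | hits t S &&
  (if thick f S then ~~ parity f M S && kept M G S else extends G S)].

Lemma weightD1 e x : x \in e -> weight e = f x + weight (e :\ x).
Proof. exact: big_setD1. Qed.

Lemma missed_thick S : thick f S -> #|missed S| = 0.
Proof.
move=> /forallP fS; apply/eqP; rewrite cards_eq0; apply/eqP/setP => j; rewrite !inE.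
apply/negbTE; rewrite negbK; have /card_gt0P[x] : 0 < #|[set x in S | f x == j]| := ltnW (fS j).
by rewrite inE => /andP[xS /eqP <-]; apply: imset_f.
Qed.

(** If e misses m blocks, the m + 1 cyclically consecutive blocks ending at the
block weight e - t cannot all be missed by e; the vertex to delete is taken in one
that is met. *)
Lemma exists_hits t e x0 : x0 \in e -> exists2 x, x \in e & hits t (e :\ x).
Proof.
move=> x0e; have l0 : 0 < l by apply: leq_ltn_trans (ltn_ord t).
have ml : #|missed e| < l.
  rewrite -[X in _ < X](card_ord l) -cardsT; apply: proper_card.
  apply/properP; split; first exact: subsetT.
  by exists (f x0); rewrite ?inE // negbK imset_f.
pose c (k : 'I_#|missed e|.+1) : 'I_l :=
  Ordinal (ltn_pmod (weight e + (l + l) - t - k) l0).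
have cE k : c k + (t + k) = weight e %[mod l].
  rewrite /c /= modnDml (_ : _ + (t + k) = weight e + (l + l)).
    by rewrite addnA !modnDr.
  have : k < l := leq_trans (ltn_ord k) ml; have := ltn_ord t.
  by move: (weight e) (nat_of_ord k) (nat_of_ord t) => w i j; lia.
have [k ck] : exists k, c k \notin missed e.
  apply/existsP; rewrite -negb_forall; apply/negP => /forallP cm.
  have cinj : injective c.
    move=> k k' ckk; apply/val_inj => /=.
    have : c k + (t + k) = c k + (t + k') %[mod l] by rewrite cE ckk cE.
    move/eqP; rewrite !eqn_modDl !modn_small; first by move/eqP.
      by apply: leq_trans (ltn_ord k') _.
    by apply: leq_trans (ltn_ord k) _.
  have : #|c @: [set: 'I_#|missed e|.+1]| <= #|missed e|.
    by apply: subset_leq_card; apply/subsetP => _ /imsetP[k _ ->].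
  by rewrite card_imset // cardsT card_ord ltnn.
move: ck; rewrite inE negbK => /imsetP[x xe cx].
exists x => //; apply/existsP.
have mm : #|missed e| <= #|missed (e :\ x)|.
  apply: subset_leq_card; apply/subsetP => j; rewrite !inE; apply: contra.
  by move=> /imsetP[y]; rewrite inE => /andP[_ ye] ->; apply: imset_f.
exists (widen_ord (mm : _.+1 <= _.+1) k) => /=.
by rewrite -(eqn_modDl (f x)) -weightD1 // -cx cE.
Qed.

Lemma thick_exch e a b : a \in e -> b \in e -> f a = f b ->
  thick f (e :\ a) -> thick f (e :\ b).
Proof.
move=> ae be fab /forallP fe; apply/forallP => j; apply: leq_trans (fe j) _.
have E x : x \in e -> #|[set y in e | f y == j]| =
    (f x == j) + #|[set y in e :\ x | f y == j]|.
  move=> xe; rewrite (cardsD1 x) !inE xe; congr (_ + #|pred_of_set _|).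
  by apply/setP => z; rewrite !inE andbA.
by have := E _ be; rewrite (E _ ae) fab => /addnI ->.
Qed.

Lemma hits_thick t S : thick f S -> hits t S -> weight S = t %[mod l].
Proof.
move=> fS /existsP[[k /= kl]] /eqP.
by move: kl; rewrite missed_thick // ltnS leqn0 => /eqP ->; rewrite addn0.
Qed.

Lemma has_private_kept M G S : has_private M G S -> kept M G S.
Proof.
move=> /exists_inP[v vR /andP[vG /forall_inP h]]; apply/exists_inP; exists v => //.
by rewrite vG; apply/forall_inP => a /h ->.
Qed.

Lemma triple_joinable e a v : a \in triple f e v -> a \in joinable f (e :\ a).
Proof.
rewrite inE => /and3P[ae _ ra]; rewrite !inE eqxx /=.
by move: ra; rewrite (block_rankD1 _ _ ae) ltnn andbF.
Qed.

(** When the accepted deletions from e are thick, either some even deletion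
owns a private edge and is kept for that reason, or no even deletion owns one and
then each of them is kept because of e. *)
Lemma turan_cover_is_cover r M t G : 0 < r -> is_rgraph r G ->
  is_cover r.-1 G (turan_cover r M t G).
Proof.
move=> r0 /subsetP rG; apply/andP; split.
  by apply/subsetP => S; rewrite inE => /andP[].
apply/forall_inP => e eG.
have /eqP ce : #|e| == r by have := rG _ eG; rewrite inE.
have /card_gt0P[x0 x0e] : 0 < #|e| by rewrite ce.
have [v ve hv] := exists_hits t x0e.
have kS a : a \in e -> (e :\ a \in ksubsets 'I_n r.-1) && (e :\ a \subset e).
  by move=> ae; rewrite inE subD1set andbT; move: ce; rewrite (cardsD1 a) ae => <-.
have [fS|nfS] := boolP (thick f (e :\ v)); last first.
  have /andP[kv sv] := kS _ ve.
  apply/exists_inP; exists (e :\ v) => //; rewrite inE kv hv (negPf nfS).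
  by apply/existsP; exists v; rewrite setD1K // eG !inE eqxx.
have vt : v \notin e :\ v by rewrite !inE eqxx.
have c3 := card_block_U1 vt fS; rewrite setD1K // in c3.
have ok a : a \in triple f e v -> ~~ parity f M (e :\ a) -> kept M G (e :\ a) ->
    [exists c in turan_cover r M t G, c \subset e].
  rewrite inE => /and3P[ae /eqP fa _] pa ka.
  have /andP[kv sv] := kS _ ae; have fSa := thick_exch ve ae (esym fa) fS.
  apply/exists_inP; exists (e :\ a) => //; rewrite inE kv fSa pa ka !andbT.
  apply/existsP; exists ord0; rewrite addn0 -(eqn_modDl (f a)) -weightD1 //.
  by rewrite (weightD1 ve) fa eqn_modDl; apply/eqP/hits_thick.
have [a at_ pa] := exists_even M c3.
have [/existsP[b /and3P[bt pb ub]]|nex] := boolP [exists b, [&& b \in triple f e v,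
    ~~ parity f M (e :\ b) & has_private M G (e :\ b)]].
  by apply: ok bt pb _; apply: has_private_kept.
apply: (ok _ at_ pa); apply/exists_inP; exists a; first exact: triple_joinable at_.
have /and3P[ae /eqP fa _] : [&& a \in e, f a == f v & block_rank f e a < 3].
  by move: at_; rewrite inE.
rewrite setD1K // eG; apply/forall_inP => b; rewrite /mates setD1K //.
have -> : triple f e a = triple f e v by apply/setP => y; rewrite !inE fa.
move=> /setD1P[_ bt]; rewrite -implyNb; apply/implyP => pb.
by apply: contra nex => ub; apply/existsP; exists b; rewrite bt pb.
Qed.

Definition toggle g M := if g \in M then M :\ g else g |: M.

Lemma toggleK g : involutive (toggle g).
Proof.
move=> M; rewrite /toggle; case: (boolP (g \in M)) => gM.
  by rewrite !inE eqxx /= setD1K.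
by rewrite setU11 setU1K.
Qed.

Lemma parity_toggle g M S : 
  parity f (toggle g M) S = parity f M S (+) (crossing f g && (g \subset core f S)).
Proof.
rewrite /parity; set P := fun g => crossing f g && (g \subset core f S).
have H g' M' : g' \notin M' -> odd #|[set h in g' |: M' | P h]| =
    odd #|[set h in M' | P h]| (+) P g'.
  move=> gM; rewrite (cardsD1 g') !inE eqxx /= oddD oddb addbC; congr (odd _ (+) _).
  by apply: eq_card => h; rewrite !inE; case: eqVneq => //= ->; rewrite (negPf gM).
rewrite /toggle; case: (boolP (g \in M)) => gM; last exact: H.
by rewrite -{2}(setD1K gM) H ?setD11 // -addbA addbb addbF.
Qed.

Lemma exists_crossing X y : thick f X -> y \in core f X ->
  exists g, [/\ crossing f g, g \subset core f X & y \in g].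
Proof.
move=> /forallP fX yX.
have /all_sig[h hP] (j : 'I_l) : {x | x \in core f X & f x == j}.
  apply/sig2_eqW; have := card_block_rank_lt (fX j) => /eqP h.
  have /card_gt0P[x] : 0 < #|[set y in X | (f y == j) && (block_rank f X y < 2)]|.
    by rewrite (eqP h).
  by rewrite !inE => /and3P[xX xj rx]; exists x; rewrite // !inE xX.
pose h' j := if j == f y then y else h j.
have fh j : f (h' j) = j.
  by rewrite /h'; case: eqVneq => [->//|_]; have [_ /eqP] := hP j.
exists (h' @: [set: 'I_l]); split.
- apply/forallP => j; apply/cards1P; exists (h' j); apply/setP => x; rewrite !inE.
  apply/andP/eqP => [[/imsetP[k _ ->]]|->]; first by rewrite fh => /eqP ->.
  by rewrite fh eqxx imset_f.
- apply/subsetP => _ /imsetP[j _ ->]; rewrite /h'; case: eqP => // _.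
  by have [] := hP j.
- by apply/imsetP; exists (f y); rewrite // /h' eqxx.
Qed.

(** The crossing set is taken through the new vertex v, so that it lies in the
exchanged set but in no set that avoids v. *)
Lemma exists_toggle S v a : thick f S -> v \in joinable f S -> a \in mates f S v ->
  exists g, [/\ v \in g,
    forall M, parity f (toggle g M) ((v |: S) :\ a) = ~~ parity f M ((v |: S) :\ a) &
    forall M (X : {set _}), v \notin X -> parity f (toggle g M) X = parity f M X].
Proof.
move=> fS vR /setD1P[av at_].
have vS : v \notin S by move: vR; rewrite inE => /andP[].
have ae : a \in v |: S by move: at_; rewrite inE => /and3P[].
have fa : f a = f v by move: at_; rewrite inE => /and3P[_ /eqP].
have fX : thick f ((v |: S) :\ a).
  by apply: (@thick_exch _ v); rewrite ?setU11 ?setU1K.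
have vX : v \in core f ((v |: S) :\ a).
  rewrite (core_rem v at_) eq_sym av setU11 eqxx /=.
  by have := mem_triple_joinable vR; rewrite inE => /and3P[].
have [g [tg sg vg]] := exists_crossing fX vX.
exists g; split => // [M|M X vnX]; rewrite parity_toggle tg /=; first by rewrite sg addbT.
rewrite (_ : _ \subset _ = false) ?addbF //; apply/negbTE.
apply: contra vnX => /subsetP/(_ _ vg); by rewrite inE => /andP[].
Qed.

Lemma thick_mates S v a : thick f S -> v \in joinable f S -> a \in mates f S v ->
  thick f ((v |: S) :\ a).
Proof.
move=> fS vR /setD1P[av]; rewrite inE => /and3P[ae /eqP fa _].
have vS : v \notin S by move: vR; rewrite inE => /andP[].
by apply: (@thick_exch _ v); rewrite ?setU11 ?setU1K.
Qed.

(** Exchanging a for v does not change the third vertex of the block of v, so the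
vertices that matter stay the same. *)
Lemma joinable_exch S v a y : v \in joinable f S -> a \in mates f S v ->
  y \in joinable f S -> y != v ->
  y \in joinable f ((v |: S) :\ a).
Proof.
rewrite !inE => /andP[vS rv] /and3P[av ae /andP[/eqP fa ra]] /andP[yS ry] yv.
rewrite !negb_and !negb_or yv yS orbT /=.
have aS : a \in S by move: ae; rewrite (negPf av).
have ae' : a \in v |: S by rewrite inE aS orbT.
have ya : a != y by apply: contraNneq yS => <-.
have := block_rankU1 f y vS; rewrite (block_rankD1 f y ae') fa.
case: eqVneq => [fy|_] /=; last by rewrite !add0n => ->.
case: (ltnP a y) => /= ay; first by
  move: (block_rank f (_ :\ a) y) (block_rank f S y) ry => A B; case: (v < y) => /=; lia.
case: (ltnP v y) => /= vy; last by rewrite !add0n => ->.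
rewrite add0n => ->; rewrite add1n ltnS.
have ya' : y < a by rewrite ltn_neqAle ay andbT eq_sym (inj_eq val_inj).
have le_block_rank : block_rank f S y <= block_rank f S a.
  apply: subset_leq_card; apply/subsetP => z; rewrite !inE fa fy.
  by move=> /and3P[-> -> zy] /=; rewrite (ltn_trans zy ya').
move: ra; rewrite block_rankU1 // fa eqxx (ltn_trans vy ya') /= add1n ltnS.
exact: leq_ltn_trans.
Qed.

End Cover.

(** * Harris' inequality at a fixed set *)

Section Exchange.
Variables (n l : nat) (f : 'I_n -> 'I_l) (S : {set 'I_n}).
Implicit Types (x y v a b : 'I_n) (M G : {set {set 'I_n}}).
Hypothesis fS : thick f S.

Definition exch v a := (v |: S) :\ a.
(** By parity_mates, a single mate decides whether y |: X is private to X. *)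
Definition mate (X : {set 'I_n}) y := odflt y [pick b in mates f X y].
(** The pairs (a, y) such that y |: exch v a would be private to the even exchanged
set exch v a. *)
Definition exch_pairs M v : {set 'I_n * 'I_n} :=
  [set ay | [&& ay.1 \in mates f S v, ay.2 \in joinable f S :\ v,
    ~~ parity f M (exch v ay.1) &
    parity f M ((ay.2 |: exch v ay.1) :\ mate (exch v ay.1) ay.2)]].
Definition exch_edges M v : {set {set 'I_n}} :=
  [set ay.2 |: exch v ay.1 | ay in exch_pairs M v].

Lemma mate_in (X : {set 'I_n}) y : thick f X -> y \in joinable f X ->
  mate X y \in mates f X y.
Proof.
move=> fX yX; rewrite /mate; case: pickP => //= h.
by have := card_mates yX fX; rewrite eq_card0.
Qed.

Lemma mates_sub v a : a \in mates f S v -> a \in S.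
Proof. by rewrite !inE => /and3P[av] /=; rewrite (negPf av). Qed.

Lemma card_exch_edges M v : v \in joinable f S -> #|exch_edges M v| = #|exch_pairs M v|.
Proof.
move=> vR; have vS : v \notin S by move: vR; rewrite inE => /andP[].
apply: card_in_imset => -[a y] [b z]; rewrite !inE /=.
move=> /and4P[/andP[av /andP[ae _]] /and3P[yv yS _] _ _].
move=> /and4P[/andP[bv /andP[be _]] /and3P[zv zS _] _ _] E.
have yz : y = z.
  have : y \in z |: exch v b by rewrite -E setU11.
  by rewrite !inE (negPf yv) (negPf yS) !andbF orbF => /eqP.
have ay : a != y by apply: contraTneq ae => ->; rewrite negb_or yv yS.
have : a \notin z |: exch v b by rewrite -E !inE eqxx /= orbF.
rewrite -yz !inE (negPf ay) ae andbT negbK => /eqP ab.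
by rewrite ab yz.
Qed.

(** An edge that makes S indispensable leaves its exchanged sets without private
edges, whereas every exchanged edge is private to an exchanged set. *)
Lemma kept_exch M G : ~~ parity f M S -> kept f M G S ->
  exists2 v, v \in joinable f S & (v |: S \in G) && [disjoint exch_edges M v & G].
Proof.
move=> pS /exists_inP[v vR /andP[vG /forall_inP h]]; exists v; rewrite // vG /=.
rewrite disjoint_subset; apply/subsetP => _ /imsetP[[a y] + ->] /=; rewrite in_set /=.
move=> /and4P[am /setD1P[yv yR] pa pb]; rewrite inE; apply/negP => yG.
have := h _ am; rewrite -/(exch v a) (negPf pa) /= => /negP[].
have fX := thick_mates fS vR am; have yX := joinable_exch vR am yR yv.
apply/exists_inP; exists y => //; rewrite yG; apply/forall_inP => b bm.
by rewrite (parity_mates (M := M) yX fX pa bm (mate_in fX yX)).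
Qed.

Lemma exch_edge_supset M v e : e \in exch_edges M v -> ~~ (S \subset e).
Proof.
move=> /imsetP[[a y] + ->] /=; rewrite in_set /= => /and4P[am /setD1P[yv yR] _ _].
have aS := mates_sub am; apply/subsetPn; exists a => //.
rewrite !in_setU1 in_setD1 eqxx /= orbF; apply: contraTneq aS => ->.
by move: yR; rewrite inE => /andP[].
Qed.

Section Probability.
Variables (R : realType) (p : R) (r : nat).
Hypotheses (p0 : 0 <= p) (p1 : p < 1) (r0 : (0 < r)%N) (cS : #|S| = r.-1).
Let p01 : 0 <= p <= 1. Proof. by rewrite p0 ltW. Qed.
Let s := enum (ksubsets 'I_n r).

Lemma star_edge v : v \notin S -> v |: S \in s.
Proof. by move=> vS; rewrite mem_enum inE cardsU1 vS cS add1n prednK. Qed.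

Lemma exch_edges_sub M v : v \in joinable f S -> {subset exch_edges M v <= s}.
Proof.
move=> vR e /imsetP[[a y] + ->] /=; rewrite in_set /= => /and4P[am /setD1P[yv yR] _ _].
have yS : y \notin S by move: yR; rewrite inE => /andP[].
have vS : v \notin S by move: vR; rewrite inE => /andP[].
rewrite mem_enum inE cardsU1 /exch in_setD1 in_setU1 (negPf yv) (negPf yS) andbF add1n.
have := cardsD1 a (v |: S); rewrite in_setU1 (mates_sub am) orbT cardsU1 vS cS.
by rewrite !add1n => -[<-]; rewrite prednK.
Qed.

(** The event that v |: S is absent or some of its exchanged edges is present is
decreasing in the edges that contain S and increasing in the other ones, for every
v, so Harris' inequality applies with the order reversed on the edges containing
S. *)
Lemma prob_not_kept_ge M : ~~ parity f M S ->
  \prod_(v in joinable f S) (1 - p * (1 - p) ^+ #|exch_pairs M v|) <=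
  Expect p s (fun G => (~~ kept f M G S)%:R).
Proof.
move=> pS.
pose F v G : R := 1 - ((v |: S \in G) && [disjoint exch_edges M v & G])%:R.
have F01 v G : 0 <= F v G <= 1.
  by rewrite /F; case: (_ && [disjoint _ & _]) => /=; lra.
apply: le_trans (_ : Expect p s (fun G => \prod_(v <- enum (joinable f S)) F v G) <= _);
    last first.
  apply: le_Expect => // G _; case: (boolP (kept f M G S)) => [/kept_exch|] /=.
    move=> /(_ pS)[v vR vG]; rewrite (big_rem v) ?mem_enum //= /F vG.
    by rewrite subrr mul0r.
  by move=> _; apply: prodr_ile1 => v _; apply: F01.
rewrite -big_enum /=.
rewrite (eq_big_seq (fun v => Expect p s (F v))); last first.
  move=> v; rewrite mem_enum => vR.
  have vS : v \notin S by move: vR; rewrite inE => /andP[].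
  rewrite ExpectB Expect_const Expect_mem_disjoint ?enum_uniq ?card_exch_edges ?star_edge //.
    exact: exch_edges_sub.
  by apply: contraTN (subsetUr [set v] S) => /exch_edge_supset.
apply: (harris p01 (up := fun e : {set 'I_n} => ~~ (S \subset e))) => [v e G|v G];
  last by case/andP: (F01 v G).
have FB (b b' : bool) : (b -> b') -> 1 - b'%:R <= 1 - b%:R :> R.
  by case: b => [/(_ isT)->//|_]; case: b' => /=; lra.
case: (boolP (S \subset e)) => [Se|nSe]; apply: FB => /andP[].
  move=> vG dG; rewrite in_setU1 vG orbT /= disjoint_sym -setI_eq0 setIUl setU_eq0.
  rewrite !setI_eq0 disjoints1 [X in _ && X]disjoint_sym dG andbT.
  by apply: contraTN Se => /exch_edge_supset.
rewrite in_setU1 => /orP[/eqP ve|->]; first by rewrite -ve subsetUr in nSe.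
by move=> dG /=; apply: disjointWr dG; apply: subsetUr.
Qed.

Lemma pow_le_exp k : (1 - p) ^+ k <= expR (- (p * k%:R)).
Proof.
rewrite -mulNr expRM_natr lerXn2r ?nnegrE ?expR_ge0 ?subr_ge0 ?(ltW p1) //.
exact: expR_ge1Dx.
Qed.

Lemma prob_not_kept_exp M : ~~ parity f M S ->
  expR (- (p / (1 - p) * \sum_(v in joinable f S) expR (- (p * #|exch_pairs M v|%:R)))) <=
  Expect p s (fun G => (~~ kept f M G S)%:R).
Proof.
move=> pS; apply: le_trans (prob_not_kept_ge pS).
rewrite mulr_sumr -sumrN expR_sum; apply: ler_prod => v _.
rewrite expR_ge0 /=; set k := #|_|; set x := p * (1 - p) ^+ k.
have q0 : 0 < 1 - p by rewrite subr_gt0.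
have q1 : (1 - p) ^+ k <= 1 by apply: exprn_ile1; [exact: ltW|by rewrite lerBlDr lerDl].
have x0 : 0 <= x by rewrite mulr_ge0 // exprn_ge0 // ltW.
have xp : x <= p by rewrite -[X in _ <= X]mulr1 ler_wpM2l.
apply: le_trans (exp_le_1B x0 (le_lt_trans xp p1)); rewrite ler_expR lerN2.
rewrite [leRHS]mulrAC; apply: ler_pM; rewrite ?invr_ge0 ?subr_ge0 //.
- by rewrite (le_trans xp) ?ltW.
- by rewrite ler_wpM2l // pow_le_exp.
- by rewrite lef_pV2 ?posrE ?subr_gt0 ?(le_lt_trans xp) // lerD2l lerN2.
Qed.

End Probability.
End Exchange.

(** * Averaging over the random family *)

Section RandomFamily.
Variables (R : realType) (n l : nat) (f : 'I_n -> 'I_l) (S : {set 'I_n}).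
Implicit Types (x y v a b : 'I_n) (M G : {set {set 'I_n}}).
Hypotheses (fS : thick f S) (S0 : S != set0).
Let Om : R := #|{: {set {set 'I_n}}}|%:R.

Lemma sum_toggle g (K : {set {set 'I_n}} -> R) :
  (forall M, K (toggle g M) = - K M) -> \sum_M K M = 0.
Proof.
move=> HK; have : \sum_M K M = \sum_M K (toggle g M).
  exact: (reindex_inj (inv_inj (@toggleK _ g))).
by rewrite [X in _ = X](eq_bigr _ (fun M _ => HK M)) sumrN => h; lra.
Qed.

Lemma sum_half (w b : {set {set 'I_n}} -> bool) g :
  (forall M, w (toggle g M) = w M) -> (forall M, b (toggle g M) = ~~ b M) ->
  \sum_M ((w M)%:R * (~~ b M)%:R : R) = 2^-1 * \sum_M (w M)%:R.
Proof.
move=> hw hb; apply/eqP; rewrite mulr_sumr -subr_eq0 -sumrB; apply/eqP.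
apply: (sum_toggle (g := g)) => M; rewrite hw hb.
by case: (w M); case: (b M); rewrite /= ?mulr0 ?mulr1 ?mul0r ?mul1r; lra.
Qed.

(** Toggling a member of the family that crosses the core of S flips its parity. *)
Lemma sum_even : \sum_M ((~~ parity f M S)%:R : R) = Om / 2.
Proof.
have [x xS] := set0Pn _ S0.
have /eqP h := card_block_rank_lt (forallP fS (f x)).
have /card_gt0P[y] : (0 < #|[set y in S | (f y == f x) && (block_rank f S y < 2)]|)%N.
  by rewrite (eqP h).
rewrite !inE => /and3P[yS _ ry].
have yc : y \in core f S by rewrite inE yS.
have [g [tg sg _]] := exists_crossing fS yc.
have := @sum_half (fun=> true) (fun M => parity f M S) g (fun=> erefl).
rewrite (eq_bigr (fun M => (~~ parity f M S)%:R)) => [->|M _]; last by rewrite mul1r.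
  by rewrite sumr_const mulrC.
by move=> M; rewrite parity_toggle tg sg addbT.
Qed.

Section Exchange.
Variables v a0 : 'I_n.
Hypotheses (vR : v \in joinable f S) (a0m : a0 \in mates f S v).
Let vS : v \notin S. Proof. by move: vR; rewrite inE => /andP[]. Qed.

Lemma sum_even_odd :
  \sum_M ((~~ parity f M S)%:R * (parity f M (exch S v a0))%:R : R) = Om / 4.
Proof.
have [g [vg hg ig]] := exists_toggle fS vR a0m.
have := @sum_half (fun M => ~~ parity f M S) (fun M => ~~ parity f M (exch S v a0)) g.
rewrite sum_even => h.
rewrite (eq_bigr _ (fun M _ => congr1 (fun b : bool => _ * b%:R) (esym (negbK _)))).
rewrite h => [|M|M]; [by field|by rewrite ig|by rewrite hg].
Qed.

Let w M := ~~ parity f M S && ~~ parity f M (exch S v a0).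

Lemma sum_even_even : \sum_M ((w M)%:R : R) = Om / 4.
Proof.
have [g [vg hg ig]] := exists_toggle fS vR a0m.
have := @sum_half (fun M => ~~ parity f M S) (fun M => parity f M (exch S v a0)) g.
rewrite sum_even => h; transitivity (2^-1 * (Om / 2)); last by field.
rewrite -h => [|M|M]; [|by rewrite ig|by rewrite hg].
by apply: eq_bigr => M _; rewrite /w; do 2!case: (parity _ _ _); rewrite /= ?mulr0 ?mulr1.
Qed.

Let c M a y : R := (parity f M ((y |: exch S v a) :\ mate f (exch S v a) y))%:R.
Let h M y : R := \sum_(a in mates f S v) (c M a y - 2^-1).

Lemma h_le1 M y : h M y ^+ 2 <= 1.
Proof.
have hn : `|h M y| <= 1.
  apply: le_trans (ler_norm_sum _ _ _) _.
  apply: le_trans (_ : \sum_(a in mates f S v) 2^-1 <= _).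
    apply: ler_sum => a _; rewrite /c; case: (parity _ _ _) => /=;
    by rewrite ler_norml; apply/andP; split; lra.
  by rewrite sumr_const card_mates //; lra.
by rewrite -real_normK ?num_real // expr_le1.
Qed.

(** For each mate a, toggling a suitable crossing set through y changes the sign of
the summand of a in h M y, while the parities of the sets avoiding y, on which w M
and h M y' depend, stay the same. *)
Lemma h_uncorrelated y y' : y \in joinable f S :\ v -> y' \in joinable f S :\ v -> y != y' ->
  \sum_M (w M)%:R * (h M y * h M y') = 0.
Proof.
move=> /setD1P[yv yR] /setD1P[y'v y'R] yy'.
have yS : y \notin S by move: yR; rewrite inE => /andP[].
rewrite (eq_bigr (fun M => \sum_(a in mates f S v)
   (w M)%:R * ((c M a y - 2^-1) * h M y'))); last first.
  by move=> M _; rewrite mulr_suml mulr_sumr.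
rewrite exchange_big big1 //= => a am.
have fX := thick_mates fS vR am; have yX := joinable_exch vR am yR yv.
have [g [yg hg ig]] := exists_toggle fX yX (mate_in fX yX).
have yE b : y \notin exch S v b by rewrite !inE negb_and !negb_or yv yS orbT.
apply: (sum_toggle (g := g)) => M; rewrite /w !ig //.
have -> : h (toggle g M) y' = h M y'.
  apply: eq_bigr => b _; rewrite /c ig // in_setD1 in_setU1 !negb_and negb_or yy' yE.
  by rewrite orbT.
have -> : c (toggle g M) a y - 2^-1 = - (c M a y - 2^-1).
  by rewrite /c hg; case: (parity _ _ _) => /=; lra.
by rewrite mulNr mulrN.
Qed.

(** The terms with y different from y' vanish, and the diagonal ones are at most 1. *)
Lemma second_moment :
  \sum_M (w M)%:R * (\sum_(y in joinable f S :\ v) h M y) ^+ 2 <= #|joinable f S|%:R * Om.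
Proof.
rewrite (eq_bigr (fun M => \sum_(y in joinable f S :\ v) \sum_(y' in joinable f S :\ v)
   (w M)%:R * (h M y * h M y'))); last first.
  move=> M _; rewrite expr2 mulr_suml mulr_sumr; apply: eq_bigr => y _.
  by rewrite mulr_sumr mulr_sumr.
rewrite exchange_big /=.
apply: le_trans (_ : \sum_(y in joinable f S :\ v) Om <= _).
  apply: ler_sum => y yR; rewrite exchange_big (bigD1 y) //= [X in _ + X]big1.
    rewrite addr0 /Om -sum1_card natr_sum; apply: ler_sum => M _.
    rewrite -expr2 -[X in _ <= X]mulr1; apply: ler_pM; rewrite ?ler0n ?sqr_ge0 //.
      by rewrite ler_nat leq_b1.
    exact: h_le1.
  by move=> y' /andP[y'R ny]; apply: h_uncorrelated; rewrite // eq_sym.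
rewrite sumr_const -[leLHS]mulr_natl ler_wpM2r ?ler0n // ler_nat.
exact/subset_leq_card/subD1set.
Qed.

(** Each of the two mates gives half an edge per vertex y on average, which cancels
the factor 2. *)
Lemma card_exch_pairs M : w M ->
  #|exch_pairs f S M v|%:R =
  #|joinable f S :\ v|%:R + \sum_(y in joinable f S :\ v) h M y :> R.
Proof.
move=> /andP[pS pa0].
have -> : #|joinable f S :\ v|%:R = \sum_(y in joinable f S :\ v) (1 : R) by rewrite sumr_const.
rewrite -big_split /=.
rewrite (eq_bigr (fun y => \sum_(a in mates f S v) c M a y)); last first.
  move=> y _; rewrite /h sumrB sumr_const card_mates //.
  by rewrite -[2^-1 *+ 2]mulr_natr mulVf ?pnatr_eq0 // addrC subrK.
rewrite exchange_big /= pair_big_dep /= -sum1_card natr_sum big_mkcond [RHS]big_mkcond.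
apply: eq_bigr => -[a y] _; rewrite in_set /=.
case am: (a \in mates f S v) => //=; case yR: (y \in joinable f S :\ v) => //=.
rewrite /exch in pa0 *; rewrite (parity_mates vR fS pS am a0m) pa0 /= /c.
by case: (parity _ _ _).
Qed.

Variable p : R.
Hypothesis p0 : 0 <= p.

(** Half of the time the exchanged sets are odd and nothing is gained; otherwise
the number of exchanged edges is close to its mean by the second moment. *)
Lemma sum_even_exp (eps : R) : 0 < eps ->
  \sum_M (~~ parity f M S)%:R * expR (- (p * #|exch_pairs f S M v|%:R)) <=
  Om * (4^-1 * (1 + expR (- (p * #|joinable f S :\ v|%:R))) +
        2^-1 * (eps + p ^+ 2 * #|joinable f S|%:R / eps)).
Proof.
move=> e0.
have q0 : 0 <= 2^-1 * (p ^+ 2 / eps).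
  by apply: mulr_ge0; [rewrite invr_ge0|rewrite divr_ge0 ?sqr_ge0 ?(ltW e0)].
set m : R := #|joinable f S :\ v|%:R; set W := fun M => \sum_(y in joinable f S :\ v) h M y.
have step M : (~~ parity f M S)%:R * expR (- (p * #|exch_pairs f S M v|%:R)) <=
   (~~ parity f M S)%:R * (parity f M (exch S v a0))%:R +
   (w M)%:R * expR (- (p * m)) +
   (2^-1 * eps + (2^-1 * (p ^+ 2 / eps)) * ((w M)%:R * W M ^+ 2)).
  have W0 : 0 <= 2^-1 * (p ^+ 2 / eps) * ((w M)%:R * W M ^+ 2).
    by apply: mulr_ge0 => //; rewrite mulr_ge0 ?sqr_ge0 ?ler0n.
  case: (boolP (parity f M S)) => pS /=; first by rewrite /w pS /= !mul0r; nra.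
  case: (boolP (parity f M (exch S v a0))) => pa /=.
    rewrite /w pS pa /= !mul0r !mul1r !mulr0 !addr0.
    by apply: le_trans (_ : 1 <= _); [rewrite -expR0 ler_expR oppr_le0 mulr_ge0|lra].
  have wM : w M by rewrite /w pS pa.
  rewrite wM !mul1r ?mulr0 ?mul0r add0r card_exch_pairs //; rewrite -/m -/(W M).
  have m0 : 0 <= m by rewrite ler0n.
  have k0 : 0 <= m + W M by rewrite -card_exch_pairs.
  apply: le_trans (exp_lip (mulr_ge0 p0 k0) (mulr_ge0 p0 m0)) _.
  rewrite lerD2l -mulrBr (addrC m) addrK normrM (ger0_norm p0).
  (* p |W M| is split by the inequality of arithmetic and geometric means *)
  have : 0 <= (eps - p * `|W M|) ^+ 2 / eps by rewrite divr_ge0 ?sqr_ge0 ?(ltW e0).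
  have -> : (eps - p * `|W M|) ^+ 2 / eps =
     eps - 2 * (p * `|W M|) + p ^+ 2 / eps * `|W M| ^+ 2.
    by field; rewrite gt_eqF.
  by rewrite real_normK ?num_real //; lra.
apply: le_trans (ler_sum _ (fun M _ => step M)) _.
rewrite !big_split /= sum_even_odd // -mulr_suml sum_even_even -2!mulr_sumr.
rewrite sumr_const -/Om -[eps *+ _]mulr_natr -/Om.
have H := ler_wpM2l q0 second_moment.
have E : 2^-1 * (p ^+ 2 / eps) * (#|joinable f S|%:R * Om) =
  Om * (2^-1 * (p ^+ 2 * #|joinable f S|%:R / eps)) by ring.
by rewrite E in H; rewrite /W; lra.
Qed.
End Exchange.

(** Jensen's inequality, in the form of the tangent of the exponential at the
intended mean mu. *)
Lemma sum_even_kept_le (p mu eps : R) r : 0 <= p -> p < 1 -> (0 < r)%N ->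
  #|S| = r.-1 -> 0 < eps ->
  (forall v, v \in joinable f S -> p / (1 - p) * #|joinable f S|%:R *
    (4^-1 * (1 + expR (- (p * #|joinable f S :\ v|%:R))) +
        2^-1 * (eps + p ^+ 2 * #|joinable f S|%:R / eps)) <= mu / 2) ->
  0 <= mu ->
  \sum_M Expect p (enum (ksubsets 'I_n r)) (fun G => (~~ parity f M S && kept f M G S)%:R) <=
  Om / 2 * (1 - expR (- mu)).
Proof.
move=> p0 p1 r0 cS e0 hmu mu0; have p01 : 0 <= p <= 1 by rewrite p0 ltW.
pose Z M := p / (1 - p) * \sum_(v in joinable f S) expR (- (p * #|exch_pairs f S M v|%:R)).
have Om0 : 0 <= Om by rewrite ler0n.
have HZ : \sum_M (~~ parity f M S)%:R * Z M <= Om * (mu / 2).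
  rewrite (eq_bigr (fun M => \sum_(v in joinable f S) p / (1 - p) *
      ((~~ parity f M S)%:R * expR (- (p * #|exch_pairs f S M v|%:R))))); last first.
    by move=> M _; rewrite /Z !mulr_sumr; apply: eq_bigr => v _; ring.
  rewrite exchange_big /=.
  have [->|Rn] := eqVneq (joinable f S) set0.
    by rewrite big_set0 mulr_ge0 // divr_ge0.
  have q0 : 0 <= p / (1 - p) by rewrite divr_ge0 // subr_ge0 ltW.
  have R0 : 0 < #|joinable f S|%:R :> R by rewrite ltr0n card_gt0.
  apply: le_trans (_ : \sum_(v in joinable f S) Om * (mu / 2) / #|joinable f S|%:R <= _).
    apply: ler_sum => v vR; rewrite -mulr_sumr ler_pdivlMr //.
    have [a am] : exists a, a \in mates f S v.
      by apply/card_gt0P; rewrite card_mates.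
    have := ler_wpM2l q0 (sum_even_exp vR am p0 e0) => H.
    apply: le_trans (ler_wpM2r (ltW R0) H) _.
    by have := ler_wpM2l Om0 (hmu v vR); apply: le_trans;
      rewrite le_eqVlt; apply/orP; left; apply/eqP; ring.
  by rewrite sumr_const -[leLHS]mulr_natr divfK // gt_eqF.
have step M : Expect p (enum (ksubsets 'I_n r)) (fun G => (~~ parity f M S && kept f M G S)%:R) <=
    (~~ parity f M S)%:R * (1 - expR (- mu) * (1 + mu)) +
    expR (- mu) * ((~~ parity f M S)%:R * Z M).
  case: (boolP (parity f M S)) => pS /=.
    rewrite !mul0r mulr0 addr0 -[leRHS](Expect_const p (enum (ksubsets 'I_n r))).
    by apply: le_Expect.
  have := prob_not_kept_exp fS p0 p1 r0 cS pS; rewrite -/(Z M) => H.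
  have T : expR (- mu) * (1 + mu - Z M) <= expR (- Z M).
    have -> : expR (- Z M) = expR (- mu) * expR (mu - Z M).
      by rewrite -expRD; congr expR; ring.
    by apply: ler_wpM2l; rewrite ?expR_ge0 // -addrA expR_ge1Dx.
  have E : Expect p (enum (ksubsets 'I_n r)) (fun G => (kept f M G S)%:R) =
     1 - Expect p (enum (ksubsets 'I_n r)) (fun G => (~~ kept f M G S)%:R).
    rewrite -[X in X - _](Expect_const p (enum (ksubsets 'I_n r)) 1) -ExpectB.
    by apply: eq_Expect => G _; case: (kept _ _ _ _) => /=; rewrite ?subr0 ?subrr.
  by rewrite E !mul1r; lra.
apply: le_trans (ler_sum _ (fun M _ => step M)) _.
rewrite big_split /= -mulr_suml -mulr_sumr sum_even.
have := ler_wpM2l (expR_ge0 (- mu)) HZ; lra.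
Qed.
End RandomFamily.

(** * Counting partitions *)

Section Restriction.
Local Open Scope nat_scope.
Variables (n l k : nat) (S : {set 'I_n}).
Hypothesis cS : #|S| = k.

Definition pos (i : 'I_k) : 'I_n := enum_val (cast_ord (esym cS) i).

Lemma pos_inj : injective pos.
Proof. by move=> i j /enum_val_inj/cast_ord_inj. Qed.

Lemma pos_im : pos @: [set: 'I_k] = S.
Proof.
apply/setP => x; apply/imsetP/idP => [[i _ ->]|xS]; first exact: enum_valP.
exists (cast_ord cS (enum_rank_in xS x)) => //.
by rewrite /pos cast_ordK enum_rankK_in.
Qed.

Definition restr (f : {ffun 'I_n -> 'I_l}) : {ffun 'I_k -> 'I_l} := [ffun i => f (pos i)].

Lemma card_fiber (g : {ffun 'I_k -> 'I_l}) :
  #|[set f | restr f == g]| * l ^ k = l ^ n.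
Proof.
pose F x := [pred z | [forall i, (pos i == x) ==> (g i == z)]].
have -> : #|[set f | restr f == g]| = #|family F|.
  apply: eq_card => f; rewrite inE; apply/eqP/familyP => [fg x|h].
    by apply/forallP => i; apply/implyP => /eqP <-; rewrite -fg ffunE.
  apply/ffunP => i; rewrite ffunE; have /forallP/(_ i) := h (pos i).
  by rewrite eqxx => /eqP.
have cF x : #|F x| * (if x \in S then l else 1) = l.
  case: (boolP (x \in S)) => xS.
    move: xS; rewrite -{1}pos_im => /imsetP[i _ ->].
    have -> : #|F (pos i)| = #|pred1 (g i)|; last by rewrite card1 mul1n.
    apply: eq_card => z; rewrite !inE; apply/forallP/eqP => [/(_ i)|-> j].
      by rewrite eqxx => /eqP.
    by apply/implyP => /eqP/pos_inj ->.
  rewrite muln1; have -> : #|F x| = #|'I_l|; last exact: card_ord.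
  apply: eq_card => z; rewrite !inE.
  apply/forallP => i; apply/implyP => /eqP ix; case/negP: xS.
  by rewrite -ix -{1}pos_im imset_f.
rewrite card_family foldrE big_map big_enum /=.
have -> : l ^ k = \prod_(x : 'I_n) (if x \in S then l else 1).
  by rewrite -big_mkcond prod_nat_const cS.
by rewrite -big_split /= (eq_bigr _ (fun x _ => cF x)) prod_nat_const card_ord.
Qed.

Lemma card_restr (P : pred {ffun 'I_k -> 'I_l}) :
  #|[set f | P (restr f)]| * l ^ k = #|[set g | P g]| * l ^ n.
Proof.
rewrite -sum1_card (partition_big restr P) => [|f]; last by rewrite inE.
rewrite big_distrl /= -[X in _ = X * _]sum1_card big_distrl /=.
rewrite [RHS](eq_bigl P) => [|g]; last by rewrite inE.
apply: eq_bigr => g Pg; rewrite mul1n -(card_fiber g) -sum1_card; congr (_ * _).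
apply: eq_bigl => f; rewrite !inE; case: eqP => [->|]; rewrite ?andbF ?andbT //.
Qed.

Lemma card_block (f : {ffun 'I_n -> 'I_l}) j :
  #|[set x in S | f x == j]| = #|[set i | restr f i == j]|.
Proof.
rewrite -(card_imset _ pos_inj); apply: eq_card => x; rewrite !inE.
apply/andP/imsetP => [[xS fx]|[i + ->]].
  by move: xS fx; rewrite -{1}pos_im => /imsetP[i _ ->] fi; exists i; rewrite // inE ffunE.
by rewrite inE ffunE => fi; rewrite -{1}pos_im imset_f.
Qed.

Lemma card_thick :
  #|[set f : {ffun 'I_n -> 'I_l} | thick f S]| * l ^ k =
  #|[set g : {ffun 'I_k -> 'I_l} | [forall b, 2 <= #|[set i | g i == b]|]]| * l ^ n.
Proof.
rewrite -card_restr; congr (_ * _); apply: eq_card => f; rewrite !inE.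
by apply: eq_forallb => j; rewrite card_block.
Qed.

Lemma sum_missed :
  (\sum_(f : {ffun 'I_n -> 'I_l}) #|missed f S|) * l ^ k = l * l.-1 ^ k * l ^ n.
Proof.
have -> : \sum_(f : {ffun 'I_n -> 'I_l}) #|missed f S| =
    \sum_(j : 'I_l) #|[set f : {ffun 'I_n -> 'I_l} | j \in missed f S]|.
  under eq_bigr do rewrite -sum1_card big_mkcond.
  rewrite exchange_big; apply: eq_bigr => j _; rewrite -sum1_card [RHS]big_mkcond.
  by apply: eq_bigr => f _; rewrite inE.
have E j : #|[set f : {ffun 'I_n -> 'I_l} | j \in missed f S]| * l ^ k = l.-1 ^ k * l ^ n.
  rewrite (_ : l.-1 ^ k = #|[set g : {ffun 'I_k -> 'I_l} | [forall i, g i != j]]|).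
    rewrite -card_restr; congr (_ * _); apply: eq_card => f; rewrite !inE.
    apply/idP/forallP => [h i|h].
      by rewrite ffunE; apply: contraNneq h => <-; rewrite imset_f // -pos_im imset_f.
    apply/negP => /imsetP[x]; rewrite -pos_im => /imsetP[i _ ->] jE.
    by have := h i; rewrite ffunE jE eqxx.
  have := card_ffun_on 'I_k (predC1 j); rewrite cardC1 !card_ord => <-.
  apply: eq_card => g; rewrite in_set; apply/ffun_onP/forallP => h i; exact: h.
by rewrite big_distrl /= (eq_bigr _ (fun j _ => E j)) sum_nat_const card_ord mulnA.
Qed.

End Restriction.

Section Hits.
Local Open Scope nat_scope.
Variables (n l : nat) (f : 'I_n -> 'I_l) (S : {set 'I_n}).

(** The residue t is determined by the shift k. *)
Lemma card_hits : 0 < l -> #|[set t : 'I_l | hits f t S]| <= #|missed f S|.+1.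
Proof.
move=> l0.
pose c (k : 'I_#|missed f S|.+1) : 'I_l := Ordinal (ltn_pmod (weight f S + l - k) l0).
have -> : #|missed f S|.+1 = #|[set: 'I_#|missed f S|.+1]| by rewrite cardsT card_ord.
apply: leq_trans (leq_imset_card c _).
apply: subset_leq_card; apply/subsetP => t; rewrite inE => /existsP[k wk].
apply/imsetP; exists k => //; apply/val_inj => /=; rewrite -[LHS](modn_small (ltn_ord t)).
apply/eqP; rewrite -(eqn_modDr k) subnK.
  by rewrite modnDr; rewrite eq_sym.
apply: leq_trans (leq_addl _ _); rewrite -ltnS; apply: leq_trans (ltn_ord k) _.
by rewrite ltnS -[X in _ <= X](card_ord l) max_card.
Qed.
End Hits.

(** * The mean of tau *)

Section Tau.
Local Open Scope nat_scope.
Variables (V : finType) (r : nat).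
Hypothesis r0 : 0 < r.
Implicit Types (G C : {set {set V}}) (e : {set V}).

Lemma ksubsets_cover G : is_rgraph r G -> is_cover r.-1 G (ksubsets V r.-1).
Proof.
move=> /subsetP rG; apply/andP; split; first exact: subxx.
apply/forall_inP => e /rG; rewrite inE => /eqP ce.
have /card_gt0P[x xe] : 0 < #|e| by rewrite ce.
apply/exists_inP; exists (e :\ x); last exact: subD1set.
by rewrite inE; move: ce; rewrite (cardsD1 x) xe => <-.
Qed.

Lemma tau_le G C : is_rgraph r G -> is_cover r.-1 G C -> tau r.-1 G <= #|C|.
Proof.
by move=> rG cC; rewrite /tau; case: arg_minnP => [|C' _]; [exact: ksubsets_cover|apply].
Qed.

Lemma tau_cover G : is_rgraph r G -> exists2 C, is_cover r.-1 G C & #|C| = tau r.-1 G.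
Proof.
move=> rG; rewrite /tau; case: arg_minnP => [|C cC _]; first exact: ksubsets_cover.
by exists C.
Qed.

Lemma tau_mono G G' : is_rgraph r G' -> G \subset G' -> tau r.-1 G <= tau r.-1 G'.
Proof.
move=> rG' GG'; have rG := subset_trans GG' rG'.
have [C /andP[kC /forall_inP cC] <-] := tau_cover rG'; apply: tau_le => //.
by rewrite /is_cover kC; apply/forall_inP => e /(subsetP GG')/cC.
Qed.

Lemma tau_add G e : is_rgraph r (e |: G) -> tau r.-1 (e |: G) <= (tau r.-1 G).+1.
Proof.
move=> reG; have rG : is_rgraph r G := subset_trans (subsetUr _ _) reG.
have : e \in ksubsets V r by apply: (subsetP reG); rewrite setU11.
rewrite inE => /eqP ce; have /card_gt0P[x xe] : 0 < #|e| by rewrite ce.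
have [C /andP[kC /forall_inP cC] <-] := tau_cover rG.
apply: leq_trans (_ : #|(e :\ x) |: C| <= _).
  apply: tau_le => //; apply/andP; split.
    rewrite subUset sub1set kC inE andbT.
    by move: ce; rewrite (cardsD1 x) xe => <-.
  apply/forall_inP => e'; rewrite in_setU1 => /orP[/eqP ->|/cC/exists_inP[c cC' ce']].
    by apply/exists_inP; exists (e :\ x); rewrite ?setU11 ?subD1set.
  by apply/exists_inP; exists c; rewrite // in_setU1 cC' orbT.
by rewrite cardsU1; case: (_ \notin _); rewrite ?add1n ?add0n.
Qed.

Lemma tau_lipschitz (R : realType) e G :
  (`|(tau r.-1 ((e |: G) :&: ksubsets V r))%:R -
     (tau r.-1 (G :&: ksubsets V r))%:R : R| <= 1)%R.
Proof.
set K := ksubsets V r; have rK A : is_rgraph r (A :&: K) := subsetIr _ _.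
have le1 : tau r.-1 (G :&: K) <= tau r.-1 ((e |: G) :&: K).
  by apply: tau_mono; rewrite ?rK // setSI // subsetUr.
have le2 : tau r.-1 ((e |: G) :&: K) <= (tau r.-1 (G :&: K)).+1.
  have [eK|eK] := boolP (e \in K).
    have E : (e |: G) :&: K = e |: (G :&: K).
      by apply/setP => x; rewrite !inE; case: eqVneq => //= ->; move: eK; rewrite inE.
    by rewrite E; apply: tau_add; rewrite -E.
  have -> : (e |: G) :&: K = G :&: K; last exact: leqnSn.
  apply/setP => x; rewrite !inE; case: eqVneq => //= ->.
  by move: eK; rewrite inE => /negPf ->; rewrite !andbF.
rewrite -natrB // normr_nat lern1; lia.
Qed.
End Tau.

Section Mean.
Variables (R : realType) (n l r : nat) (p mu eps : R).
Hypotheses (p0 : 0 <= p) (p1 : p < 1) (l0 : (0 < l)%N) (r1 : (1 < r)%N).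
Hypotheses (mu0 : 0 <= mu) (eps0 : 0 < eps).
Let N := (n - r.-1)%N.
Hypothesis hmu : forall k : nat, (k.+1 <= N)%N ->
  p / (1 - p) * k.+1%:R * (4^-1 * (1 + expR (- (p * k%:R))) +
    2^-1 * (eps + p ^+ 2 * k.+1%:R / eps)) <= mu / 2.
Let r0 : (0 < r)%N. Proof. exact: ltnW. Qed.
Let p01 : 0 <= p <= 1. Proof. by rewrite p0 ltW. Qed.
Let s := enum (ksubsets 'I_n r).
Let Om : R := #|{: {set {set 'I_n}}}|%:R.
Let B : R := 1 - (1 - p) ^+ N.
Let A : R := 1 - expR (- mu).

Lemma Expect_extends (S : {set 'I_n}) : #|S| = r.-1 ->
  Expect p s (fun G => (extends G S)%:R) = B.
Proof.
move=> cS; pose E := [set v |: S | v in ~: S].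
have sE : {subset E <= s}.
  by move=> e /imsetP[v + ->]; rewrite inE; apply: star_edge.
have cE : #|E| = N.
  rewrite card_in_imset; first by rewrite cardsCs setCK card_ord cS.
  move=> v v'; rewrite !inE => vS v'S E'.
  have : v \in v' |: S by rewrite -E' setU11.
  by rewrite in_setU1 (negPf vS) orbF => /eqP.
rewrite /B -cE -(Expect_disjoint p (enum_uniq _) sE) -[X in X - _](Expect_const p s) -ExpectB.
apply: eq_Expect => G _; rewrite (_ : extends G S = ~~ [disjoint E & G]).
  by case: [disjoint _ & _]; rewrite /= ?subr0 ?subrr.
rewrite -setI_eq0; apply/existsP/set0Pn => [[v /andP[vS vG]]|[e]].
  by exists (v |: S); rewrite inE vG andbT; apply/imsetP; exists v; rewrite ?inE.
by rewrite inE => /andP[/imsetP[v + ->]]; rewrite inE => vS eG; exists v; rewrite vS.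
Qed.

Lemma B_ge0 : 0 <= B.
Proof.
rewrite subr_ge0; apply: exprn_ile1; first by rewrite subr_ge0 ltW.
by rewrite lerBlDr lerDl.
Qed.

Lemma sum_hits (f : 'I_n -> 'I_l) S :
  \sum_t (hits f t S)%:R <= #|missed f S|.+1%:R :> R.
Proof.
rewrite -natr_sum ler_nat; apply: leq_trans (card_hits f S l0).
rewrite -sum1_card [leqRHS]big_mkcond; apply: leq_sum => t _; rewrite inE.
by case: (hits _ _ _).
Qed.

(** A thick set misses no block and is accepted for one residue only; any other set
is accepted for at most one residue more than the number of blocks it misses. *)
Lemma cover_prob_partition (f : 'I_n -> 'I_l) (S : {set 'I_n}) : #|S| = r.-1 ->
  \sum_(t : 'I_l) \sum_M Expect p s (fun G => (S \in turan_cover f r M t G)%:R) <=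
  Om * ((thick f S)%:R * (2^-1 * A) + ((~~ thick f S)%:R + #|missed f S|%:R) * B).
Proof.
move=> cS; have kS : S \in ksubsets 'I_n r.-1 by rewrite inE cS.
have Om0 : 0 <= Om by rewrite ler0n.
have [fS|nfS] := boolP (thick f S).
  pose X := \sum_M Expect p s (fun G => (~~ parity f M S && kept f M G S)%:R).
  have X0 : 0 <= X by apply: sumr_ge0 => M _; apply: Expect_ge0.
  apply: le_trans (_ : \sum_t (hits f t S)%:R * X <= _).
    apply: ler_sum => t _; rewrite mulr_sumr; apply: ler_sum => M _; rewrite -ExpectZ.
    by apply: le_Expect => // G _; rewrite inE kS fS /=; case: (hits _ _ _); rewrite ?mul1r ?mul0r.
  rewrite -mulr_suml missed_thick //= mul1r addr0 mul0r addr0.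
  have h1 := sum_hits f S; rewrite missed_thick // in h1.
  apply: le_trans (ler_wpM2r X0 h1) _; rewrite mul1r.
  have S0 : S != set0 by rewrite -card_gt0 cS -ltnS prednK.
  have := sum_even_kept_le fS S0 p0 p1 r0 cS eps0 _ mu0.
  rewrite -/X -/Om -/A => H; apply: le_trans (H _) _; last by rewrite mulrA.
  move=> v vR; have := cardsD1 v (joinable f S); rewrite vR add1n => cR.
  rewrite cR; apply: hmu; rewrite -cR.
  have : (#|joinable f S| <= #|~: S|)%N.
    by apply: subset_leq_card; apply/subsetP => x; rewrite !inE => /andP[].
  by rewrite [#|~: S|]cardsCs setCK card_ord cS.
apply: le_trans (_ : \sum_t (hits f t S)%:R * (Om * B) <= _).
  apply: ler_sum => t _; rewrite mulrA -[(hits _ _ _)%:R * Om]mulrC -mulrA.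
  rewrite /Om mulr_natl -sumr_const; apply: ler_sum => M _.
  rewrite -(Expect_extends cS) -ExpectZ.
  by apply: le_Expect => // G _; rewrite inE kS (negPf nfS) /=;
    case: (hits _ _ _); rewrite ?mul1r ?mul0r.
rewrite -mulr_suml mul0r add0r.
apply: le_trans (ler_wpM2r (mulr_ge0 Om0 B_ge0) (sum_hits f S)) _.
by rewrite mulrCA nat1r.
Qed.

Lemma cover_prob (S : {set 'I_n}) : #|S| = r.-1 ->
  \sum_(f : {ffun 'I_n -> 'I_l}) \sum_(t : 'I_l) \sum_M
    Expect p s (fun G => (S \in turan_cover f r M t G)%:R) <=
  (l ^ n)%:R * l%:R * Om * (zeta1 R r l / (2 * l%:R) * A +
     (zeta2 R r l / l%:R + (1 - l%:R^-1) ^+ r.-1) * B).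
Proof.
move=> cS; apply: le_trans (ler_sum _ (fun (f : {ffun _}) _ => cover_prob_partition f cS)) _.
have lR : l%:R != 0 :> R by rewrite pnatr_eq0 -lt0n.
have lk : (l ^ r.-1)%:R != 0 :> R by rewrite pnatr_eq0 expn_eq0 negb_and -lt0n l0.
have Hz : \sum_(f : {ffun 'I_n -> 'I_l}) (thick f S)%:R = (l ^ n)%:R * zeta1 R r l.
  rewrite -natr_sum /zeta1 card_ffun !card_ord mulrA; apply: (canRL (mulfK lk)).
  rewrite -!natrM mulnC [X in _ = X%:R]mulnC -(card_thick l cS) [in RHS]mulnC.
  congr (_ * _)%:R; rewrite -sum1_card [RHS]big_mkcond.
  by apply: eq_bigr => f _; rewrite inE.
have Hm : \sum_(f : {ffun 'I_n -> 'I_l}) #|missed f S|%:R =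
    (l ^ n)%:R * l%:R * (1 - l%:R^-1) ^+ r.-1 :> R.
  have -> : 1 - l%:R^-1 = l.-1%:R / l%:R :> R.
    by rewrite -subn1 natrB //; field.
  rewrite -natr_sum expr_div_n mulrA -natrX -[in l%:R ^+ _]natrX; apply: (canRL (mulfK lk)).
  rewrite -[LHS]natrM (sum_missed l cS) !natrM; ring.
rewrite -mulr_sumr big_split /= -!mulr_suml big_split /= Hz Hm.
have -> : \sum_(f : {ffun 'I_n -> 'I_l}) (~~ thick f S)%:R = (l ^ n)%:R * zeta2 R r l.
  rewrite /zeta2 mulrBr -Hz mulr1.
  have -> : (l ^ n)%N = #|{: {ffun 'I_n -> 'I_l}}| by rewrite card_ffun !card_ord.
  rewrite -sum1_card natr_sum -sumrB; apply: eq_bigr => f _.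
  by case: (thick _ _); rewrite /= ?subrr ?subr0.
by rewrite le_eqVlt; apply/orP; left; apply/eqP; field.
Qed.

(** For every choice of partition, residue and family the cover bounds tau, hence so
does the average of its size over all choices. *)
Lemma mean_tau_le : Expect p s (fun G => (tau r.-1 G)%:R) <=
  'C(n, r.-1)%:R * (zeta1 R r l / (2 * l%:R) * A +
     (zeta2 R r l / l%:R + (1 - l%:R^-1) ^+ r.-1) * B).
Proof.
set T := Expect _ _ _; set D : R := (l ^ n)%:R * l%:R * Om.
have D0 : 0 < D.
  rewrite !mulr_gt0 ?ltr0n ?expn_gt0 ?l0 //; apply/card_gt0P; by exists set0.
rewrite -(ler_pM2l D0).
have -> : D * T = \sum_(f : {ffun 'I_n -> 'I_l}) \sum_(t : 'I_l) \sum_(M : {set {set 'I_n}}) T.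
  have cF : #|{: {ffun 'I_n -> 'I_l}}| = (l ^ n)%N by rewrite card_ffun !card_ord.
  rewrite 3!sumr_const cF (card_ord l) -3![_ *+ _]mulr_natr /D /Om.
  by rewrite mulrC mulrA mulrA mulrAC [in RHS]mulrAC; congr (_ * _); rewrite mulrAC.
apply: le_trans (_ : \sum_(f : {ffun 'I_n -> 'I_l}) \sum_(t : 'I_l) \sum_M
   \sum_(S in ksubsets 'I_n r.-1) Expect p s (fun G => (S \in turan_cover f r M t G)%:R) <= _).
  apply: ler_sum => f _; apply: ler_sum => t _; apply: ler_sum => M _.
  rewrite -Expect_sum; apply: le_Expect => // G sG.
  have rG : is_rgraph r G by apply/subsetP => e /sG; rewrite mem_enum.
  rewrite -natr_sum ler_nat; apply: leq_trans (tau_le r0 rG (turan_cover_is_cover f M t r0 rG)) _.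
  rewrite -sum1_card big_mkcond [leqRHS]big_mkcond; apply: leq_sum => S _.
  by rewrite inE; case: (_ \in ksubsets _ _); case: (hits _ _ _ && _).
apply: le_trans (_ : \sum_(S in ksubsets 'I_n r.-1) D * (zeta1 R r l / (2 * l%:R) * A +
     (zeta2 R r l / l%:R + (1 - l%:R^-1) ^+ r.-1) * B) <= _).
  under eq_bigr do under eq_bigr do rewrite exchange_big.
  under eq_bigr do rewrite exchange_big.
  rewrite exchange_big; apply: ler_sum => S; rewrite inE => /eqP cS.
  exact: cover_prob.
rewrite sumr_const card_draws card_ord -mulr_natr; lra.
Qed.

End Mean.

(** * Bounds on psi *)

Section Asymptotics.
Variable R : realType.

Lemma zeta1_01 r l : 0 <= zeta1 R r l <= 1.
Proof.
rewrite /zeta1 divr_ge0 ?ler0n //=; set m := #|{: _}|.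
have [->|m0] := posnP m; first by rewrite invr0 mulr0.
by rewrite ler_pdivrMr ?ltr0n // mul1r ler_nat max_card.
Qed.

Lemma le_bin m k : (0 < k)%N -> (m <= 'C(m + k, k))%N.
Proof.
case: k => // k _; elim: k => [|k IH]; first by rewrite addn1 bin1.
by rewrite addnS binS (leq_trans IH) // leq_addl.
Qed.

Lemma psi_ge r l (d : R) : (0 < l)%N -> 0 <= d ->
  (1 - expR (- (d / 2))) / (2 * l%:R) <= psi r l d.
Proof.
move=> l0 d0; have /andP[z0 z1] := zeta1_01 r l.
have lR : 1 <= l%:R :> R by rewrite ler1n.
have li : 0 < (l%:R^-1 : R) by rewrite invr_gt0; lra.
have e1 : expR (- (d / 2 * (1 + expR (- d)))) <= expR (- (d / 2)).
  by rewrite ler_expR lerN2 mulrDr mulr1 lerDl mulr_ge0 ?expR_ge0 // divr_ge0.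
have e2 : expR (- d) <= expR (- (d / 2)) by rewrite ler_expR lerN2; lra.
have e3 : expR (- (d / 2)) <= 1 by rewrite expR_le1; lra.
have q0 : 0 <= (1 - l%:R^-1 : R) ^+ r.-1 by rewrite exprn_ge0 // subr_ge0 invf_le1 //; lra.
rewrite /psi /zeta2 invfM.
set z := zeta1 R r l in z0 z1 *; set q := _ ^+ _ in q0 *; set u := l%:R^-1 in li *.
set E := expR (- (d / 2)) in e1 e2 e3 *.
set E1 := expR _ in e1 *; set E2 := expR (- d) in e2 *.
have i1 : z * u / 2 * (1 - E) <= z * (2^-1 * u) * (1 - E1).
  rewrite (_ : z * u / 2 = z * (2^-1 * u)); last by ring.
  apply: ler_wpM2l; last by rewrite lerD2l lerN2.
  by apply: mulr_ge0 => //; apply: mulr_ge0; [rewrite invr_ge0|exact: ltW].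
have i2 : (1 - z) * u * (1 - E) <= ((1 - z) * u + q) * (1 - E2).
  have zu : 0 <= (1 - z) * u by rewrite mulr_ge0 ?subr_ge0 ?(ltW li).
  by apply: ler_pM; rewrite ?subr_ge0 ?lerDl ?lerD2l ?lerN2.
have i3 : 0 <= (1 - z) * u * (1 - E) by apply: mulr_ge0; rewrite ?mulr_ge0 ?subr_ge0 ?(ltW li).
apply: le_trans (lerD i1 i2); lra.
Qed.
End Asymptotics.

(** * Concentration and error terms *)

Section Tail.
Variables (R : realType) (n r l : nat) (p d a b t : R).
Let N := (n - r.-1)%N.
Hypotheses (r1 : (1 < r)%N) (l0 : (0 < l)%N) (rn : (r <= n)%N).
Hypotheses (p0 : 0 <= p) (p2 : p <= 2^-1) (dN : d = N%:R * p).
Hypotheses (a0 : 0 < a) (ad : a <= d) (db : d <= b) (t0 : 0 < t).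
(* t = N^(-1/4): t ^+ 2 balances the two error terms of the second moment bound, and
   t is the relative slack left for Chebyshev's inequality. *)
Hypothesis (tN : t ^+ 4 * N%:R = 1).
Let s := enum (ksubsets 'I_n r).

Lemma Hr_probE (E : pred {set {set 'I_n}}) :
  Hr_prob r p E = Expect p s (fun G => (E G)%:R).
Proof.
rewrite ExpectE ?enum_uniq // /Hr_prob big_mkcondr /=.
apply: eq_big => [G|G _]; first by rewrite /is_rgraph; apply: eq_subset_r => e; rewrite mem_enum.
by rewrite /Hr_mass big_enum /=; case: (E G); rewrite ?mulr1 ?mulr0.
Qed.

Let p1 : p < 1. Proof. by apply: le_lt_trans p2 _; lra. Qed.
Let q0 : 0 < 1 - p. Proof. by rewrite subr_gt0. Qed.
Let d0 : 0 <= d. Proof. by rewrite ltW // (lt_le_trans a0). Qed.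
Let b0 : 0 <= b. Proof. exact: le_trans d0 db. Qed.
Let N1 : 1 <= N%:R :> R.
Proof. by rewrite ler1n subn_gt0 (leq_trans _ rn) // prednK // ltnW. Qed.
Let t1 : t <= 1.
Proof.
have h : t ^+ 4 <= 1.
  by rewrite -tN -[leLHS]mulr1; apply: ler_wpM2l => //; rewrite exprn_ge0 ?ltW.
by rewrite -(@expr_le1 _ 4) // ltW.
Qed.
Let pE : p = d * t ^+ 4.
Proof. by rewrite dN mulrAC [N%:R * _]mulrC tN mul1r. Qed.
Let t42 : t ^+ 4 <= t ^+ 2.
Proof. by rewrite ler_wiXn2l // ltW. Qed.

Let h : R := d / 2 * (1 + expR (- d)).
Let D : R := d * t ^+ 2 * (1 + d ^+ 2).
(** The exponent h of psi, enlarged to absorb the factors exp p and 1 / (1 - p) and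
the second moment error D. *)
Let mu : R := (expR p * h + D) / (1 - p).

Let h0 : 0 <= h.
Proof. by rewrite mulr_ge0 ?divr_ge0 // addr_ge0 ?expR_ge0. Qed.
Let D0 : 0 <= D.
Proof. by rewrite !mulr_ge0 ?exprn_ge0 ?addr_ge0 ?sqr_ge0 // ltW. Qed.
Let ep1 : 1 <= expR p.
Proof. by apply: le_trans (expR_ge1Dx p); rewrite lerDl. Qed.

Lemma mu_ge : h <= mu.
Proof. by have := (ep1, h0, D0, p0) => -[[[e1 e2] e3] e4]; rewrite /mu ler_pdivlMr //; nra. Qed.

Lemma mu_le : mu - h <= 6 * (p * d) + 2 * D.
Proof.
have [p0' p1' d0' h0' D0'] := And5 p0 p1 d0 h0 D0.
have i1 := inv_1B_le p0 p2; have i2 := expR_le_inv p1.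
have i0 : 0 <= (1 - p)^-1 by rewrite invr_ge0 ltW.
have hd : h <= d.
  have : expR (- d) <= 1 by rewrite expR_le1; lra.
  by rewrite /h; nra.
have i3 : expR p * (1 - p)^-1 <= (1 + 2 * p) * (1 + 2 * p).
  by apply: ler_pM; rewrite ?expR_ge0 //; exact: le_trans i1.
have i4 : expR p * (1 - p)^-1 * h <= (1 + 2 * p) * (1 + 2 * p) * h by apply: ler_wpM2r.
have i5 : D * (1 - p)^-1 <= D * (1 + 2 * p) by apply: ler_wpM2l.
rewrite /mu mulrDl mulrAC.
have ph : 0 <= p * h by apply: mulr_ge0.
have phd : p * h <= p * d by apply: ler_wpM2l.
have pph : p * (p * h) <= 2^-1 * (p * h) by apply: ler_wpM2r.
have pD : D * p <= D * 2^-1 by apply: ler_wpM2l.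
lra.
Qed.

(** The left-hand side is increasing in k up to factors close to 1, by
le_x1expNx, and k.+1 * p is at most d. *)
Lemma mu_dominates k : (k.+1 <= N)%N ->
  p / (1 - p) * k.+1%:R * (4^-1 * (1 + expR (- (p * k%:R))) +
    2^-1 * (t ^+ 2 + p ^+ 2 * k.+1%:R / t ^+ 2)) <= mu / 2.
Proof.
have [p0' p1' d0' h0' D0'] := And5 p0 p1 d0 h0 D0.
rewrite -(ler_nat R) => kN; set x : R := p * k.+1%:R.
have x0 : 0 <= x by rewrite mulr_ge0.
have xd : x <= d by rewrite dN /x mulrC ler_wpM2r.
have t20 : 0 < t ^+ 2 by rewrite exprn_gt0.
have e1 : p ^+ 2 * k.+1%:R / t ^+ 2 <= d ^+ 2 * t ^+ 2.
  rewrite ler_pdivrMr //.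
  have -> : d ^+ 2 * t ^+ 2 * t ^+ 2 = p ^+ 2 * N%:R * (t ^+ 4 * N%:R).
    by rewrite dN; ring.
  by rewrite tN mulr1 ler_wpM2l ?sqr_ge0.
have e2 : expR (- (p * k%:R)) = expR p * expR (- x).
  by rewrite -expRD /x -natr1; congr expR; ring.
have e3 := le_x1expNx x0 xd.
have e4 : x * (1 + expR p * expR (- x)) <= expR p * (x * (1 + expR (- x))).
  have := ler_wpM2l x0 ep1; lra.
have e5 : expR p * (x * (1 + expR (- x))) <= expR p * (d * (1 + expR (- d))).
  by apply: ler_wpM2l; rewrite ?expR_ge0.
have e6 : x * (t ^+ 2 + p ^+ 2 * k.+1%:R / t ^+ 2) <= d * (t ^+ 2 + d ^+ 2 * t ^+ 2).
  apply: ler_pM; rewrite ?lerD2l // addr_ge0 ?(ltW t20) //.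
  by rewrite divr_ge0 ?(ltW t20) // mulr_ge0 ?sqr_ge0.
rewrite (_ : p / (1 - p) * k.+1%:R = x / (1 - p)); last by rewrite mulrAC.
rewrite /mu [leRHS]mulrAC [leLHS]mulrAC; apply: ler_wpM2r; first by rewrite invr_ge0 ltW.
rewrite e2 mulrDr /D /h; lra.
Qed.

Let eta : R := (12 * b ^+ 2 + 2 * b * (1 + b ^+ 2)) * t ^+ 2.

Lemma mean_tau_psi :
  Expect p s (fun G => (tau r.-1 G)%:R) <= 'C(n, r.-1)%:R * (psi r l d + eta).
Proof.
have [p0' p1' d0' h0' D0'] := And5 p0 p1 d0 h0 D0.
have mu0 : 0 <= mu := le_trans h0 mu_ge.
have t20 : 0 < t ^+ 2 by rewrite exprn_gt0.
apply: le_trans (mean_tau_le p0 p1 l0 r1 mu0 t20 mu_dominates) _.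
apply: ler_wpM2l; rewrite ?ler0n //.
have /andP[z0 z1] := zeta1_01 R r l.
have lR : 1 <= l%:R :> R by rewrite ler1n.
have li : 0 <= (l%:R^-1 : R) by rewrite invr_ge0.
have li1 : (l%:R^-1 : R) <= 1 by rewrite invf_le1 //; lra.
have w0 : 0 <= (1 - l%:R^-1 : R) ^+ r.-1 by rewrite exprn_ge0 // subr_ge0.
have w1 : (1 - l%:R^-1 : R) ^+ r.-1 <= 1.
  by rewrite exprn_ile1 ?subr_ge0 // lerBlDr lerDl.
have c1 : expR (- h) - expR (- mu) <= mu - h.
  have := exp_lip h0 mu0; rewrite ler0_norm ?subr_le0 ?mu_ge //; lra.
have c2 : expR (- d) - (1 - p) ^+ N <= 2 * (p * d).
  have i1 := inv_1B_le p0 p2.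
  have dp : d <= d / (1 - p) by rewrite ler_pdivlMr //; nra.
  have dp' : d / (1 - p) <= d * (1 + 2 * p) by apply: ler_wpM2l.
  have : expR (- (d / (1 - p))) <= (1 - p) ^+ N.
    rewrite dN -mulrA -mulrN expRM_natl lerXn2r ?nnegrE ?expR_ge0 ?(ltW q0) //.
    exact: exp_le_1B.
  have := exp_lip d0 (le_trans d0 dp).
  rewrite ler0_norm ?subr_le0 //; lra.
have zl0 : 0 <= zeta1 R r l / (2 * l%:R) by rewrite divr_ge0 // mulr_ge0.
have zl1 : zeta1 R r l / (2 * l%:R) <= 1.
  by rewrite ler_pdivrMr; lra.
have wl0 : 0 <= zeta2 R r l / l%:R + (1 - l%:R^-1) ^+ r.-1.
  by rewrite addr_ge0 // mulr_ge0 // subr_ge0.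
have wl1 : zeta2 R r l / l%:R + (1 - l%:R^-1) ^+ r.-1 <= 2.
  have : zeta2 R r l / l%:R <= 1 by rewrite /zeta2 ler_pdivrMr; lra.
  lra.
have pd0 : 0 <= p * d by rewrite mulr_ge0.
have f1 : zeta1 R r l / (2 * l%:R) * (expR (- h) - expR (- mu)) <=
    6 * (p * d) + 2 * D.
  apply: le_trans (ler_wpM2l zl0 (le_trans c1 mu_le)) _.
  by rewrite -[leRHS]mul1r; apply: ler_wpM2r => //; lra.
have f2 : (zeta2 R r l / l%:R + (1 - l%:R^-1) ^+ r.-1) * (expR (- d) - (1 - p) ^+ N) <=
    4 * (p * d).
  apply: le_trans (ler_wpM2l wl0 c2) _.
  by rewrite (_ : 4 * (p * d) = 2 * (2 * (p * d))); [apply: ler_wpM2r; lra|ring].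
have g1 : p * d <= b ^+ 2 * t ^+ 2.
  rewrite pE mulrAC -expr2; apply: ler_pM; rewrite ?sqr_ge0 ?exprn_ge0 ?(ltW t0) //.
  by rewrite lerXn2r.
have g2 : D <= b * t ^+ 2 * (1 + b ^+ 2).
  apply: ler_pM.
  - by apply: mulr_ge0; rewrite // ltW.
  - by rewrite addr_ge0 ?sqr_ge0.
  - by apply: ler_wpM2r; rewrite // ltW.
  - by rewrite lerD2l lerXn2r.
have B0 : 0 <= b ^+ 2 * t ^+ 2 by rewrite mulr_ge0 ?sqr_ge0.
rewrite /psi -/h /eta; lra.
Qed.

Let c : R := (1 - expR (- (a / 2))) / (2 * l%:R).
Let K : R := (12 * b ^+ 2 + 2 * b * (1 + b ^+ 2) + 1) / c.

Lemma c_gt0 : 0 < c.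
Proof.
by rewrite divr_gt0 ?mulr_gt0 ?ltr0n // subr_gt0 expR_lt1 oppr_lt0 divr_gt0.
Qed.

(** The variance of tau is at most 'C(n, r) p, which is at most C d for
C = 'C(n, r.-1); the slack in Chebyshev's inequality is C t, and C >= N = t^(-4).
The lower bound c on psi turns this additive slack into the factor 1 + K t. *)
Lemma tail_bound :
  1 - b * t <= Hr_prob r p (fun G : {set {set 'I_n}} =>
    (tau r.-1 G)%:R < (1 + K * t) * 'C(n, r.-1)%:R * psi r l d) <= 1.
Proof.
have [p0' p1' d0' h0' D0'] := And5 p0 p1 d0 h0 D0.
have p01 : 0 <= p <= 1 by rewrite p0 ltW.
have r0 : (0 < r)%N := ltnW r1.
have [t0' t1' N1' a0' ad'] := And5 t0 t1 N1 a0 ad; have b0' := b0.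
set E := fun G => _; rewrite Hr_probE; apply/andP; split; last first.
  by rewrite -[leRHS](Expect_const p s); apply: le_Expect => // G _; case: (E G).
pose f G : R := (tau r.-1 (G :&: ksubsets 'I_n r))%:R.
have sf (G : {set {set 'I_n}}) : {subset G <= s} -> f G = (tau r.-1 G)%:R.
  move=> sG; rewrite /f (setIidPl _) //; apply/subsetP => e /sG.
  by rewrite mem_enum.
set C : R := 'C(n, r.-1)%:R.
have C1 : N%:R <= C.
  rewrite ler_nat -[X in 'C(X, _)](subnK (_ : r.-1 <= n)%N).
    by apply: le_bin; rewrite -ltnS prednK.
  by rewrite (leq_trans (leq_pred _)).
have C0 : 0 < C by apply: lt_le_trans C1; lra.
pose A := C * (psi r l d + eta + t).
have mf : Expect p s f <= C * (psi r l d + eta).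
  by rewrite (eq_Expect _ sf); exact: mean_tau_psi.
have Ct : 0 < C * t by rewrite mulr_gt0.
have mA : C * t <= A - Expect p s f by rewrite /A; lra.
have psic : c <= psi r l d.
  apply: le_trans _ (psi_ge r l0 d0); apply: ler_wpM2r.
    by rewrite invr_ge0 mulr_ge0.
  rewrite lerD2l lerN2 ler_expR; lra.
have HA : A <= (1 + K * t) * C * psi r l d.
  rewrite /A mulrAC [leRHS]mulrC; apply: ler_wpM2l; first exact: ltW.
  have KE : K * c = 12 * b ^+ 2 + 2 * b * (1 + b ^+ 2) + 1.
    by rewrite divfK // gt_eqF ?c_gt0.
  have K0 : 0 <= K.
    rewrite divr_ge0 ?(ltW c_gt0) // !addr_ge0 // !mulr_ge0 ?sqr_ge0 //.
    by rewrite addr_ge0 ?sqr_ge0.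
  have := ler_wpM2l (mulr_ge0 K0 (ltW t0)) psic; rewrite mulrAC KE.
  have t2t : t ^+ 2 <= t by rewrite expr2 -[leRHS]mulr1 ler_wpM2l // ltW.
  have B0 : 0 <= 12 * b ^+ 2 + 2 * b * (1 + b ^+ 2).
    by rewrite addr_ge0 // !mulr_ge0 ?sqr_ge0 // addr_ge0 ?sqr_ge0.
  have := ler_wpM2l B0 t2t; rewrite /eta; lra.
have EE : 1 - Expect p s (fun G => (A <= f G)%R%:R) <= Expect p s (fun G => (E G)%:R).
  rewrite -[X in X - _](Expect_const p s) -ExpectB; apply: le_Expect => // G sG.
  rewrite /E -sf //; case: (boolP (A <= f G)) => [_|]; first by rewrite subrr ler0n.
  by rewrite -ltNge => fA; rewrite (lt_le_trans fA HA) subr0.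
apply: le_trans EE; rewrite lerD2l lerN2.
apply: le_trans (chebyshev_Expect p01 _ _) _.
- by rewrite -subr_gt0; apply: lt_le_trans mA.
- by move=> e G; apply: tau_lipschitz.
have szs : (size s)%:R * p <= C * d.
  rewrite /s -cardE card_draws card_ord dN mulrA; apply: ler_wpM2r => //.
  rewrite -natrM ler_nat -{1}(prednK r0) mulnC -mul_bin_left prednK //.
  by rewrite leq_pmull.
apply: le_trans (_ : C * d / (C * t) ^+ 2 <= _).
  apply: ler_pM; rewrite ?mulr_ge0 ?invr_ge0 ?sqr_ge0 //.
  have dA := lt_le_trans Ct mA.
  rewrite lef_pV2 ?posrE ?exprn_gt0 //.
  by rewrite lerXn2r // nnegrE ltW.
have -> : C * d / (C * t) ^+ 2 = d / t ^+ 2 / C by field; rewrite !gt_eqF.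
rewrite ler_pdivrMr // ler_pdivrMr ?exprn_gt0 //.
have h1 : d <= b * (t ^+ 4 * N%:R) by rewrite tN mulr1.
apply: le_trans h1 _; rewrite (_ : b * t * C * t ^+ 2 = b * (t ^+ 3 * C)); last by ring.
apply: ler_wpM2l => //; apply: ler_pM; rewrite ?exprn_ge0 ?ler0n ?(ltW t0) //.
by rewrite ler_wiXn2l // ltW.
Qed.
End Tail.

(** * The limit *)

Local Open Scope classical_set_scope.
Local Open Scope ring_scope.

(** This is (n - (r - 1))^(-1/4) for n >= r, and 1 for smaller n. *)
Definition fourth_root_inv (R : realType) (r n : nat) : R :=
  Num.sqrt (Num.sqrt ((n - r).+1%:R^-1)).

Lemma fourth_root_inv_cvg0 (R : realType) r : fourth_root_inv R r @ \oo --> (0 : R).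
Proof.
rewrite -(cvg_shiftn r) /=.
have -> : (fun n => fourth_root_inv R r (n + r)) =
    (fun n => Num.sqrt (Num.sqrt (harmonic n : R))).
  by apply/funext => n; rewrite /fourth_root_inv addnK.
have sqrt_cvg0 (u : nat -> R) : u @ \oo --> (0 : R) ->
    (fun n => Num.sqrt (u n)) @ \oo --> (0 : R).
  move=> u0; have := continuous_cvg _ (@sqrt_continuous R 0) u0.
  by rewrite sqrtr0; exact.
exact/sqrt_cvg0/sqrt_cvg0/cvg_harmonic.
Qed.

Theorem theorem1p14 (R : realType) (r l : nat) (p d : nat -> R)
    (hr : (3 <= r)%N) (hl : (1 <= l)%N) (hlr : (2 * l <= r)%N)
    (hp : forall n, 0 <= p n <= 1)
    (hd : forall n, d n = (n%:R - r.-1%:R) * p n)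
    (hTheta : is_Theta1 d) :
  exists eps : nat -> R,
    eps @ \oo --> (0 : R) /\
    (fun n => Hr_prob r (p n) (fun G : {set {set 'I_n}} =>
       (tau r.-1 G)%:R < (1 + eps n) * 'C(n, r.-1)%:R * psi r l (d n)))
      @ \oo --> (1 : R).
Proof.
have [a [b [a0 b0 dab]]] := hTheta.
pose K := (12 * b ^+ 2 + 2 * b * (1 + b ^+ 2) + 1) / ((1 - expR (- (a / 2))) / (2 * l%:R)).
pose t := fourth_root_inv R r; have t0 : t @ \oo --> (0 : R) := @fourth_root_inv_cvg0 R r.
exists (fun n => K * t n); split.
  by rewrite -[X in _ --> X](mulr0 K); apply: cvgM; [exact: cvg_cst|].
apply: (@squeeze_cvgr _ _ _ _ (fun n => 1 - b * t n) (fun=> 1)); last 2 first.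
- rewrite -[X in _ --> X]subr0 -(mulr0 b).
  by apply: cvgB; [exact: cvg_cst|apply: cvgM; [exact: cvg_cst|]].
- exact: cvg_cst.
near=> n.
have /andP[ad db] : a <= d n <= b by near: n.
have rn : (r <= n)%N by near: n; exact: nbhs_infty_ge.
(* large enough for p n <= 1/2 *)
have bn : 2 * b + r%:R <= n%:R by near: n; exact: nbhs_infty_ger.
have r0 : (0 < r)%N by apply: leq_trans hr.
have NE : (n - r.-1)%N = (n - r).+1 by lia.
have dN : d n = (n - r.-1)%:R * p n.
  by rewrite hd natrB // (leq_trans (leq_pred _)).
have /andP[p0 _] := hp n.
have tn0 : 0 < t n by rewrite !sqrtr_gt0 invr_gt0 ltr0n.
have tN : t n ^+ 4 * (n - r.-1)%:R = 1.
  rewrite NE -[4%N]/(2 * 2)%N exprM !sqr_sqrtr ?sqrtr_ge0 ?invr_ge0 ?ler0n //.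
  by rewrite mulVf // pnatr_eq0.
have p2 : p n <= 2^-1.
  have NR : (n - r).+1%:R = 1 + (n%:R - r%:R) :> R by rewrite -natrB // nat1r.
  have Nb : 2 * b <= (n - r.-1)%:R by rewrite NE NR; lra.
  have := ler_wpM2r p0 Nb; rewrite -dN; nra.
exact: (tail_bound (ltnW hr) hl rn p0 p2 dN a0 ad db tn0 tN).
Unshelve. all: by end_near.
Qed.
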